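(* Let $f:S^2\to S^2$ be a Thurston map of degree $2$. If $|P_{f}|\geq 4$, then the pullback map $\Sigma_{f}$ is not constant.
   Context: $S^2$ is an oriented topological 2-sphere and all maps $S^2\to S^2$ are orientation preserving. For a branched cover $f:S^2\to S^2$ with set of critical points $\Omega_f$, the postcritical set is $P_f=\bigcup_{m>0} f^{\circ m}(\Omega_f)$; $f$ is a Thurston map if $P_f$ is finite. Pullback map (Teichm\''uller map). For a Thurston map $f$, the Teichm\''uller space $\mathcal{T}_f$ is the space of complex structures on the orbifold $\mathcal{O}_f$ with underlying space $S^2$ and singular points in $P_f$, up to isotopy fixing $P_f$; equivalently, it is the set of orientation-preserving homeomorphisms $\varphi:S^2\to\mathbb{P}^1$ (the Riemann sphere), where $\varphi_1\sim\varphi_2$ if there is a M\''obius transformation $M$ with $M\circ\varphi_1$ isotopic to $\varphi_2$ rel $P_f$. The map $\Sigma_f:\mathcal{T}_f\to\mathcal{T}_f$ is induced by pulling back complex structures under $f$ (and extending over the punctures): $\Sigma_f([\varphi])=[\psi]$, where $\psi:S^2\to\mathbb{P}^1$ is an orientation-preserving homeomorphism such that $\varphi\circ f\circ\psi^{-1}$ is holomorphic. *)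

(* Defs.v *)
From HB Require Import structures.
From mathcomp Require Import all_boot all_order all_algebra.
From mathcomp Require Import all_classical all_reals all_analysis.
From mathcomp Require Import complex.

Set Implicit Arguments.
Unset Strict Implicit.
Unset Printing Implicit Defensive.

Import Order.TTheory GRing.Theory Num.Theory.
Import numFieldNormedType.Exports.

Local Open Scope classical_set_scope.
Local Open Scope ring_scope.
Local Open Scope complex_scope.

(* The numFieldType ascription is what gives R[i] its usual topology and its
   structure of normed space over itself. *)
Definition cplx (R : realType) : numFieldType := R[i].

Record homeo (T U : topologicalType) := Homeo {
  homeo_fun :> T -> U;
  homeo_inv : U -> T;
  homeoK : cancel homeo_fun homeo_inv;
  homeo_invK : cancel homeo_inv homeo_fun;
  homeo_continuous : continuous homeo_fun;
  homeo_inv_continuous : continuous homeo_inv }.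

Definition is_homeo (T U : topologicalType) (g : T -> U) : Prop :=
  exists h : homeo T U, g = h.

Definition homeo_on (T U : topologicalType) (A : set T) (B : set U)
    (g : T -> U) : Prop :=
  [/\ set_bij A B g, {within A, continuous g} &
    exists h : U -> T,
      {within B, continuous h} /\ forall x, A x -> h (g x) = x].

(* The Riemann sphere: [Some z] is the point z of C, [None] is infinity. *)
Definition P1 (R : realType) := one_point_compactification (cplx R).

(* The standard holomorphic chart of P1 around p and its inverse: the
   coordinate z if p is finite, and 1/z if p is infinity.  Values outside the
   domain of the chart are irrelevant. *)
Definition P1_coord (R : realType) (p q : P1 R) : cplx R :=
  match p, q with
  | Some _, Some z => z
  | Some _, None => 0
  | None, Some z => z^-1
  | None, None => 0
  end.

Definition P1_param (R : realType) (p : P1 R) (w : cplx R) : P1 R :=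
  match p with
  | Some _ => Some w
  | None => if w == 0 then None else Some w^-1
  end.

(* F read in the standard charts around p and F p. *)
Definition P1_local (R : realType) (F : P1 R -> P1 R) (p : P1 R) :
    cplx R -> cplx R :=
  fun w => P1_coord (F p) (F (P1_param p w)).

Definition holomorphic (R : realType) (F : P1 R -> P1 R) : Prop :=
  forall p : P1 R,
    {for p, continuous F} /\ derivable (P1_local F p) (P1_coord p p) 1.

Definition moebius (R : realType) (a b c d : cplx R) (p : P1 R) : P1 R :=
  match p with
  | Some z => if c * z + d == 0 then None else Some ((a * z + b) / (c * z + d))
  | None => if c == 0 then None else Some (a / c)
  end.

Definition is_moebius (R : realType) (M : P1 R -> P1 R) : Prop :=
  exists a b c d : cplx R, a * d - b * c != 0 /\ M = moebius a b c d.

Definition cis (R : realType) (t : R) : cplx R := cos t +i* sin t.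

(* The image under g of every small circle centred at z0, run
   counterclockwise, has winding number 1 around g z0: theta is a continuous
   argument and m the modulus of g - g z0 along the circle.  For a local
   homeomorphism g this says that g preserves the orientation of C at z0. *)
Definition oriented_at (R : realType) (g : cplx R -> cplx R) (z0 : cplx R) :
    Prop :=
  exists2 r : R, 0 < r & forall rho : R, 0 < rho < r ->
    exists theta m : R -> R,
      [/\ {within `[0, 2 * pi], continuous theta},
          forall t : R, 0 <= t <= 2 * pi ->
            0 < m t /\
            g (z0 + rho%:C * cis t) - g z0 = (m t)%:C * cis (theta t)
        & theta (2 * pi) - theta 0 = 2 * pi].

(* An oriented topological 2-sphere: its orientation is the one transported
   from the complex orientation of P1 by [sphere_ref]. *)
Record oriented_sphere (R : realType) := OrientedSphere {
  sphere_carrier :> topologicalType;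
  sphere_ref : homeo sphere_carrier (P1 R) }.

(* Orientation preservation at x of a map defined near x on the sphere. *)
Definition preserves_orientation_at (R : realType) (S : oriented_sphere R)
    (g : S -> P1 R) (x : S) : Prop :=
  let p := sphere_ref S x in
  oriented_at (P1_local (g \o homeo_inv (sphere_ref S)) p) (P1_coord p p).

Definition unit_disk (R : realType) : set (cplx R) := [set z | `|z| < 1].
Arguments unit_disk : clear implicits.

Definition disk_chart (R : realType) (S : oriented_sphere R) (x : S)
    (U : set S) (a : S -> cplx R) : Prop :=
  [/\ open U, U x, a x = 0, homeo_on U (unit_disk R) a &
    forall y, U y ->
      preserves_orientation_at (fun z => Some (a z) : P1 R) y].

(* In orientation-preserving charts centred at x and f x, f is z |-> z ^ d. *)
Definition local_degree (R : realType) (S : oriented_sphere R) (f : S -> S)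
    (x : S) (d : nat) : Prop :=
  (0 < d)%N /\
  exists (U V : set S) (a b : S -> cplx R),
    [/\ disk_chart x U a, disk_chart (f x) V b &
      forall y, U y -> V (f y) /\ b (f y) = a y ^+ d].

Definition branched_cover (R : realType) (S : oriented_sphere R)
    (f : S -> S) : Prop :=
  continuous f /\ forall x, exists d, local_degree f x d.

Definition critical_points (R : realType) (S : oriented_sphere R)
    (f : S -> S) : set S :=
  [set x | exists2 d, (1 < d)%N & local_degree f x d].

(* The common number of preimages of the points that are not critical values
   (there are only finitely many critical values, by compactness). *)
Definition has_degree (R : realType) (S : oriented_sphere R)
    (f : S -> S) (d : nat) : Prop :=
  forall y, ~ (f @` critical_points f) y -> (f @^-1` [set y] #= `I_d)%card.

Definition postcritical_set (R : realType) (S : oriented_sphere R)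
    (f : S -> S) : set S :=
  \bigcup_(m in [set m | (0 < m)%N]) (iter m f @` critical_points f).

Definition thurston_map (R : realType) (S : oriented_sphere R)
    (f : S -> S) : Prop :=
  branched_cover f /\ finite_set (postcritical_set f).

Definition isotopic_rel (R : realType) (S : oriented_sphere R) (A : set S)
    (g h : S -> P1 R) : Prop :=
  exists H : R -> S -> P1 R,
    [/\ {within [set p : R * S | 0 <= p.1 <= 1],
          continuous (fun p : R * S => H p.1 p.2)},
        H 0 = g, H 1 = h,
        forall t, 0 <= t <= 1 -> is_homeo (H t)
      & forall t x, 0 <= t <= 1 -> A x -> H t x = g x].

Record marking (R : realType) (S : oriented_sphere R) := Marking {
  marking_homeo :> homeo S (P1 R);
  marking_oriented : forall x, preserves_orientation_at marking_homeo x }.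

Definition teich_equiv (R : realType) (S : oriented_sphere R) (f : S -> S)
    (phi1 phi2 : marking S) : Prop :=
  exists2 M : P1 R -> P1 R, is_moebius M &
    isotopic_rel (postcritical_set f) (M \o phi1) phi2.

Definition teich_class (R : realType) (S : oriented_sphere R) (f : S -> S)
    (phi : marking S) : set (marking S) :=
  [set psi | teich_equiv f phi psi].

Definition teich_space (R : realType) (S : oriented_sphere R) (f : S -> S) :
    Type :=
  {c : set (marking S) | exists phi, c = teich_class f phi}.

Definition teich (R : realType) (S : oriented_sphere R) (f : S -> S)
    (phi : marking S) : teich_space f :=
  exist _ (teich_class f phi) (ex_intro _ phi erefl).

(* The property defining the map Sigma_f.  By the standard theory, every phi
   admits a psi as below and its class depends only on the class of phi, so
   that exactly one map Sigma satisfies it. *)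
Definition is_pullback_map (R : realType) (S : oriented_sphere R) (f : S -> S)
    (Sigma : teich_space f -> teich_space f) : Prop :=
  forall phi psi : marking S,
    holomorphic (phi \o f \o homeo_inv psi) ->
    Sigma (teich f phi) = teich f psi.

(* Main.v *)
Require Import Defs.
From HB Require Import structures.
From mathcomp Require Import all_boot all_order all_algebra.
From mathcomp Require Import all_classical all_reals all_analysis.
From mathcomp Require Import complex ring lra.

(** The reason why the pullback map is not constant is that it moves the
    cross-ratios of the points of the postcritical set [P_f].

    A branched cover of degree two of the sphere has exactly two critical
    points [c1] and [c2], so that, up to the choice of markings, it is the map
    [z |-> z ^+ 2].  If [phi] is a marking with [phi (f c1) = 0] and
    [phi (f c2) = oo], then [phi \o f] is the square of a marking [psi]
    ([root_marking]), and the pullback of the class of [phi] is the class of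
    [psi].  Two points of [P_f] are critical at most, so let [p1] be a point of
    [P_f] that is neither [c1] nor [c2], and write [psi p1 = s].  Composing
    [phi] with a homeomorphism supported near [phi (f p1) = s ^+ 2] that moves
    this point to [s ^+ 2 + eps * r] changes [psi] as follows
    ([moved_pullback]): up to a common sign, the point [psi p1] becomes a
    square root [v] of [s ^+ 2 + eps * r], the point [q] such that
    [psi q = - s] is sent to [- v], and the other points of [P_f] do not move.
    Were the pullback map constant, a Moebius transformation would carry the
    old positions of the points of [P_f] to the new ones.  If [q] is not in
    [P_f], this transformation fixes three points up to sign, so it cannot
    move [s] ([moebius_three]).  If [q] is in [P_f], there are two other
    points [p3] and [p4] in [P_f], and [p3] may be taken noncritical, for
    otherwise [P_f], being the union of the critical values and of [f @` P_f],
    would be contained in [{f p1, f c1, f c2}].  The transformation then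
    determines [v ^+ 2] from [s], [psi p3] and [psi p4] ([moebius_pair]),
    which is absurd since [eps] is arbitrary.

    The existence of [psi] is a matter of logarithms.  A nonvanishing
    continuous function on the plane has a continuous logarithm
    ([plane_log]), and so has one on the punctured plane if its winding number
    is 0 ([annular_log]).  By the latter, a map preserves orientation at [z0]
    if and only if [(g z - g z0) / (z - z0)] has a logarithm near [z0]
    ([winds]), which makes orientation easy to transport.  The two points of
    each fibre of [f] are exchanged by a continuous involution ([cts_deck])
    whose fixed points are the critical points.  There is at least one, since
    [P_f] is not empty; a single one is impossible because an involution of
    the plane has a fixed point ([plane_involution_fixed]).  Once two critical
    points and their images are placed at 0 and infinity, [f] becomes a map
    [g] of the plane that winds twice around 0, so [g z = (z * cexp (u z)) ^+ 2].
    The square root [z * cexp (u z)] changes sign under the involution, for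
    otherwise it would descend to a square root of the identity of the
    punctured plane ([root_deck]); so it is a bijection. *)

Set Implicit Arguments.
Unset Strict Implicit.
Unset Printing Implicit Defensive.

Import Order.TTheory GRing.Theory Num.Theory.
Import numFieldNormedType.Exports.

Local Open Scope classical_set_scope.
Local Open Scope ring_scope.
Local Open Scope complex_scope.

Local Notation Re := complex.Re.
Local Notation Im := complex.Im.

(** * The complex exponential and its local inverses *)

Section ComplexBasics.
Variable R : realType.
Notation C := (cplx R).
Implicit Types (z w : C) (x y t : R).

(** The modulus as an element of [R]; the norm of [C] takes its values in
    [C] itself. *)
Definition cabs (z : C) : R := Re `|z|.

Lemma cabsE z : `|z| = (cabs z)%:C.
Proof. by []. Qed.

Lemma cabs_def z : cabs z = Num.sqrt (Re z ^+ 2 + Im z ^+ 2).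
Proof. by rewrite /cabs normc_def. Qed.

Lemma cabs_ge0 z : 0 <= cabs z.
Proof. by rewrite cabs_def sqrtr_ge0. Qed.

Lemma cabsM z w : cabs (z * w) = cabs z * cabs w.
Proof.
by apply: (@complexI R); rewrite rmorphM /= -!cabsE normrM.
Qed.

Lemma cabs0 : cabs 0 = 0.
Proof. by apply: (@complexI R); rewrite -cabsE normr0. Qed.

Lemma cabs1 : cabs 1 = 1.
Proof. by apply: (@complexI R); rewrite -cabsE normr1. Qed.

Lemma cabs_eq0 z : (cabs z == 0) = (z == 0).
Proof.
by rewrite -(inj_eq (@complexI R)) -cabsE /= normr_eq0.
Qed.

Lemma cabs_gt0 z : (0 < cabs z) = (z != 0).
Proof. by rewrite lt0r cabs_ge0 andbT cabs_eq0. Qed.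

Lemma cabsN z : cabs (- z) = cabs z.
Proof. by apply: (@complexI R); rewrite -!cabsE normrN. Qed.

Lemma cabsB z w : cabs (z - w) = cabs (w - z).
Proof. by rewrite -cabsN opprB. Qed.

Lemma cabsD z w : cabs (z + w) <= cabs z + cabs w.
Proof. by rewrite -lecR rmorphD /= -!cabsE ler_normD. Qed.

Lemma cabsV z : cabs z^-1 = (cabs z)^-1.
Proof.
by apply: (@complexI R); rewrite -cabsE normfV fmorphV.
Qed.

Lemma cabsX z n : cabs (z ^+ n) = cabs z ^+ n.
Proof. by elim: n => [|n IH]; rewrite ?cabs1 // !exprS cabsM IH. Qed.

Lemma cabs_real x : cabs x%:C = `|x|.
Proof. by rewrite cabs_def /= expr0n addr0 sqrtr_sqr. Qed.

Lemma cabs_sub_ge z w : cabs z - cabs w <= cabs (z - w).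
Proof. by rewrite lerBlDr; have := cabsD (z - w) w; rewrite subrK. Qed.

Lemma Re_cabs z : `|Re z| <= cabs z.
Proof.
by rewrite cabs_def -(sqrtr_sqr (Re z)); apply: ler_wsqrtr; rewrite lerDl sqr_ge0.
Qed.

Lemma Im_cabs z : `|Im z| <= cabs z.
Proof.
by rewrite cabs_def -(sqrtr_sqr (Im z)); apply: ler_wsqrtr; rewrite lerDr sqr_ge0.
Qed.

Lemma cabs_ReIm z : cabs z <= `|Re z| + `|Im z|.
Proof.
have h : 0 <= `|Re z| + `|Im z| by rewrite addr_ge0.
rewrite cabs_def -[leRHS](ger0_norm h) -[leRHS]sqrtr_sqr; apply: ler_wsqrtr.
rewrite sqrrD !real_normK ?num_real//.
have := mulr_ge0 (normr_ge0 (Re z)) (normr_ge0 (Im z)); lra.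
Qed.

Lemma cplxP z w : Re z = Re w -> Im z = Im w -> z = w.
Proof. by case: z w => a b [c d] /= -> ->. Qed.

Lemma ReD z w : Re (z + w) = Re z + Re w.
Proof. by case: z w => a b [c d]. Qed.

Lemma ImD z w : Im (z + w) = Im z + Im w.
Proof. by case: z w => a b [c d]. Qed.

Lemma ReB z w : Re (z - w) = Re z - Re w.
Proof. by case: z w => a b [c d]. Qed.

Lemma ImB z w : Im (z - w) = Im z - Im w.
Proof. by case: z w => a b [c d]. Qed.

Lemma ReN z : Re (- z) = - Re z.
Proof. by case: z. Qed.

Lemma nbhsC z (A : set C) :
  nbhs z A <-> exists2 e : R, 0 < e & forall w, cabs (w - z) < e -> A w.
Proof.
split=> [/nbhs_normP[e /= e0 H]|[e e0 H]].
  have eR : e = (Re e)%:C by rewrite RRe_real // ger0_real // ltW.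
  exists (Re e); first by rewrite -ltcR -eR.
  move=> w h; apply: H => /=; rewrite distrC cabsE.
  by rewrite eR ltcR.
apply/nbhs_normP; exists e%:C; first by rewrite /= ltcR.
by move=> w /=; rewrite distrC cabsE ltcR; exact: H.
Qed.

Lemma nbhs_disc z (e : R) : 0 < e -> nbhs z [set w | cabs (w - z) < e].
Proof. by move=> e0; apply/nbhsC; exists e. Qed.

(** Continuity at a point, wrapped so that unification treats it as atomic. *)
Variant cts (T U : topologicalType) (f : T -> U) (p : T) : Prop :=
  Cts of {for p, continuous f}.

Lemma ctsP (T U : topologicalType) (f : T -> U) (p : T) :
  cts f p <-> {for p, continuous f}.
Proof. by split=> [[]|H]. Qed.

Lemma ctsT (T U : topologicalType) (f : T -> U) :
  continuous f <-> forall p, cts f p.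
Proof. by split=> [H p|H p]; [split; exact: H | apply/ctsP; exact: H]. Qed.

Lemma nbhsRP (T : topologicalType) (p : T) (f : T -> R) :
  (forall e : R, 0 < e -> \forall q \near p, `|f p - f q| < e) <-> cts f p.
Proof.
split=> [H|[H]]; first by split; apply/(@cvgrPdist_lt _ R _ (nbhs p)) => //.
by move=> e e0; move/(@cvgrPdist_lt _ R _ (nbhs p)) : H; apply.
Qed.

Lemma cts_Re_at z : cts (@Re R : C -> R) z.
Proof.
apply/nbhsRP => e e0; apply/nbhsC; exists e => // w h.
by rewrite -ReB (le_lt_trans (Re_cabs _))// cabsB.
Qed.

Lemma cts_Im_at z : cts (@Im R : C -> R) z.
Proof.
apply/nbhsRP => e e0; apply/nbhsC; exists e => // w h.
by rewrite -ImB (le_lt_trans (Im_cabs _))// cabsB.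
Qed.

Lemma cts_cabs_at z : cts cabs z.
Proof.
apply/nbhsRP => e e0; apply/nbhsC; exists e => // w h.
apply: le_lt_trans h; rewrite ler_norml; apply/andP; split.
  by rewrite lerNl opprB cabs_sub_ge.
by rewrite cabsB cabs_sub_ge.
Qed.

Section ContinuityAt.
Variables (T : topologicalType) (p : T).

Lemma cts_near (U : topologicalType) (f : T -> U) (A : set U) :
  cts f p -> nbhs (f p) A -> \forall q \near p, A (f q).
Proof. by case=> cf; exact: cf. Qed.

Lemma cts_near_eq (U : topologicalType) (f g : T -> U) :
  (\forall q \near p, f q = g q) -> cts f p -> cts g p.
Proof.
move=> e [cf]; have ep := nbhs_singleton e; rewrite /= in ep; split.
rewrite /prop_for /continuous_at -ep; apply: cvg_trans cf; exact: near_eq_cvg.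
Qed.

Lemma cts_ext (U : topologicalType) (f g : T -> U) :
  (forall q, f q = g q) -> cts f p -> cts g p.
Proof. by move=> e; apply: cts_near_eq; exact: nearW. Qed.

Lemma cts_comp (U V : topologicalType) (g : U -> V) (f : T -> U) :
  cts g (f p) -> cts f p -> cts (fun q => g (f q)) p.
Proof. by case=> cg [cf]; split; exact: (cvg_comp _ _ cf cg). Qed.

Lemma cts_complex (f g : T -> R) :
  cts f p -> cts g p -> cts (fun q => (f q +i* g q : C)) p.
Proof.
move=> cf cg; split=> A /nbhsC[e e0 H].
have e2 : 0 < e / 2 by rewrite divr_gt0.
move/nbhsRP/(_ _ e2) : cf => cf; move/nbhsRP/(_ _ e2) : cg => cg.
change (\forall q \near p, A (f q +i* g q)).
near=> q; apply: H; apply: le_lt_trans (cabs_ReIm _) _ => /=.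
by rewrite (splitr e) ltrD // distrC; near: q.
Unshelve. all: by end_near. Qed.

Lemma cts_cst (U : topologicalType) (c : U) : cts (fun _ : T => c) p.
Proof. by split; exact: cvg_cst. Qed.

Lemma cts_id : cts (fun q : T => q) p.
Proof. by split; exact: cvg_id. Qed.

Lemma cts_real (f : T -> R) : cts f p -> cts (fun q => (f q)%:C : C) p.
Proof. by move=> cf; apply: cts_complex cf _; exact: cts_cst. Qed.

Lemma cts_Re (f : T -> C) : cts f p -> cts (fun q => Re (f q)) p.
Proof. by apply: cts_comp; exact: cts_Re_at. Qed.

Lemma cts_Im (f : T -> C) : cts f p -> cts (fun q => Im (f q)) p.
Proof. by apply: cts_comp; exact: cts_Im_at. Qed.

Lemma cts_cabs (f : T -> C) : cts f p -> cts (fun q => cabs (f q)) p.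
Proof. by apply: cts_comp; exact: cts_cabs_at. Qed.

Lemma cts_add (K : numFieldType) (f g : T -> K) :
  cts f p -> cts g p -> cts (fun q => f q + g q) p.
Proof. by case=> cf [cg]; split; exact: cvgD. Qed.

Lemma cts_opp (K : numFieldType) (f : T -> K) : cts f p -> cts (fun q => - f q) p.
Proof. by case=> cf; split; exact: cvgN. Qed.

Lemma cts_sub (K : numFieldType) (f g : T -> K) :
  cts f p -> cts g p -> cts (fun q => f q - g q) p.
Proof. by case=> cf [cg]; split; exact: cvgB. Qed.

Lemma cts_mul (K : numFieldType) (f g : T -> K) :
  cts f p -> cts g p -> cts (fun q => f q * g q) p.
Proof. by case=> cf [cg]; split; exact: cvgM. Qed.

Lemma cts_mull (K : numFieldType) (c : K) (f : T -> K) : cts f p -> cts (fun q => c * f q) p.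
Proof. by apply: cts_mul; exact: cts_cst. Qed.

Lemma cts_mulr (K : numFieldType) (c : K) (f : T -> K) : cts f p -> cts (fun q => f q * c) p.
Proof. by move=> cf; apply: cts_mul cf _; exact: cts_cst. Qed.

Lemma cts_addl (K : numFieldType) (c : K) (f : T -> K) : cts f p -> cts (fun q => c + f q) p.
Proof. by apply: cts_add; exact: cts_cst. Qed.

Lemma cts_addr (K : numFieldType) (c : K) (f : T -> K) : cts f p -> cts (fun q => f q + c) p.
Proof. by move=> cf; apply: cts_add cf _; exact: cts_cst. Qed.

Lemma cts_inv (K : numFieldType) (f : T -> K) : f p != 0 ->
  cts f p -> cts (fun q => (f q)^-1) p.
Proof. by move=> h [cf]; split; exact: cvgV. Qed.

Lemma cts_div (K : numFieldType) (f g : T -> K) : g p != 0 ->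
  cts f p -> cts g p -> cts (fun q => f q / g q) p.
Proof. by move=> h cf cg; apply: cts_mul cf _; exact: cts_inv. Qed.

Lemma cts_exp (K : numFieldType) (f : T -> K) n : cts f p -> cts (fun q => f q ^+ n) p.
Proof.
move=> cf; elim: n => [|n IH]; first exact: cts_cst.
apply: (cts_ext (f := fun q => f q * f q ^+ n)); last exact: cts_mul.
by move=> q; rewrite exprS.
Qed.

End ContinuityAt.

Definition cexp (z : C) : C := (expR (Re z))%:C * cis (Im z).

Lemma cisD x y : cis (x + y) = cis x * cis y.
Proof. by rewrite /cis cosD sinD; simpc; congr (_ +i* _); rewrite addrC. Qed.

Lemma cis0 : cis 0 = 1 :> C.
Proof. by rewrite /cis cos0 sin0. Qed.

Lemma cabs_cis t : cabs (cis t) = 1.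
Proof. by rewrite cabs_def /= cos2Dsin2 sqrtr1. Qed.

Lemma cis_neq0 t : cis t != 0.
Proof. by rewrite -cabs_gt0 cabs_cis. Qed.

Lemma cis_2pi t : cis (t + 2 * pi) = cis t.
Proof. by rewrite /cis mulr_natl cosD2pi sinD2pi. Qed.

Lemma cexpD z w : cexp (z + w) = cexp z * cexp w.
Proof. by rewrite /cexp ReD ImD expRD cisD rmorphM /=; ring. Qed.

Lemma cexp0 : cexp 0 = 1.
Proof. by rewrite /cexp /= expR0 cis0 mul1r. Qed.

Lemma cexp_neq0 z : cexp z != 0.
Proof.
by apply: mulf_neq0 (cis_neq0 _); rewrite -cabs_eq0 cabs_real normr_eq0 gt_eqF ?expR_gt0.
Qed.

Lemma cexpN z : cexp (- z) = (cexp z)^-1.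
Proof.
by apply: (mulfI (cexp_neq0 z)); rewrite -cexpD subrr cexp0 mulfV ?cexp_neq0.
Qed.

Lemma cexpB z w : cexp (z - w) = cexp z / cexp w.
Proof. by rewrite cexpD cexpN. Qed.

Lemma cabs_cexp z : cabs (cexp z) = expR (Re z).
Proof. by rewrite cabsM cabs_cis mulr1 cabs_real gtr0_norm ?expR_gt0. Qed.

Definition period : C := 0 +i* (2 * pi).

Lemma cexp_period : cexp period = 1.
Proof. by rewrite /cexp /= expR0 mul1r -[2 * pi]add0r cis_2pi cis0. Qed.

Lemma cexpD_period z : cexp (z + period) = cexp z.
Proof. by rewrite cexpD cexp_period mulr1. Qed.

Lemma cexp_ipi : cexp (0 +i* pi) = -1.
Proof. by rewrite /cexp /= expR0 mul1r /cis cospi sinpi; apply: cplxP => //=; rewrite oppr0. Qed.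

Lemma cexp_half z : cexp (z / 2) ^+ 2 = cexp z.
Proof. by rewrite expr2 -cexpD; congr cexp; field. Qed.

Lemma cts_cis t : cts (@cis R : R -> C) t.
Proof.
by apply: cts_complex; split; [exact: continuous_cos | exact: continuous_sin].
Qed.

Lemma cts_cexp_at z : cts cexp z.
Proof.
apply: (@cts_mul _ _ _ (fun z : C => (expR (Re z))%:C) (fun z : C => cis (Im z))).
  apply/cts_real/(cts_comp (f := @Re R : C -> R)); last exact: cts_Re_at.
  by split; exact: continuous_expR.
by apply: (cts_comp (f := @Im R : C -> R)); [exact: cts_cis | exact: cts_Im_at].
Qed.

Lemma cts_cexp (T : topologicalType) (p : T) (f : T -> C) :
  cts f p -> cts (fun q => cexp (f q)) p.
Proof. by apply: cts_comp; exact: cts_cexp_at. Qed.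

Lemma cexp_eq1 z : cexp z = 1 -> Re z = 0 /\ sin (Im z / 2) = 0.
Proof.
move=> e; have h : Re z = 0.
  by apply: (@expR_inj R); rewrite expR0 -cabs_cexp e cabs1.
split=> //; move/(congr1 (@Re R)): e; rewrite /cexp h expR0 mul1r /= => c1.
have := cos_mulr2n (Im z / 2); rewrite -[_ *+ 2]mulr_natr divfK // c1.
by move=> c; apply/eqP; rewrite -sqrf_eq0 sin2cos2; apply/eqP; lra.
Qed.

(** The principal logarithm of the right half-plane. *)
Definition logR (z : C) : C := ln (cabs z) +i* atan (Im z / Re z).

Lemma logRK z : 0 < Re z -> cexp (logR z) = z.
Proof.
move=> h; have z0 : 0 < cabs z.
  by apply: lt_le_trans (Re_cabs z); rewrite normr_gt0 gt_eqF.
rewrite /cexp /= lnK ?posrE //.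
set q := Im z / Re z.
have c0 : 0 < cos (atan q).
  by apply: cos_gt0_pihalf; rewrite atan_gtNpi2 atan_ltpi2.
have sE : sin (atan q) = q * cos (atan q).
  by rewrite -{2}(atanK q) /tan divfK // gt_eqF.
have cE : cabs z * cos (atan q) = Re z.
  rewrite cos_atan cabs_def.
  have -> : 1 + q ^+ 2 = (Re z ^+ 2 + Im z ^+ 2) / (Re z) ^+ 2.
    by rewrite /q; field; rewrite gt_eqF.
  rewrite sqrtrM ?addr_ge0 ?sqr_ge0 // sqrtrV ?sqr_ge0 // sqrtr_sqr gtr0_norm //.
  rewrite invfM invrK mulrA mulfV ?mul1r // gt_eqF // sqrtr_gt0.
  by rewrite ltr_wpDr ?sqr_ge0 // exprn_gt0.
have c1 : cabs z * sin (atan q) = Im z.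
  by rewrite sE mulrCA cE /q divfK // gt_eqF.
by apply: cplxP; rewrite /cis /=; rewrite ?cE ?c1 mul0r ?subr0 ?addr0.
Qed.

Lemma cts_logR z : 0 < Re z -> cts logR z.
Proof.
move=> h; have z0 : 0 < cabs z.
  by apply: lt_le_trans (Re_cabs z); rewrite normr_gt0 gt_eqF.
apply: cts_complex.
  apply: (cts_comp (f := cabs)); last exact: cts_cabs_at.
  by split; exact: continuous_ln.
apply: (@cts_comp _ _ _ _ (@atan R) (fun w : C => Im w / Re w)).
  by split; exact: continuous_atan.
apply: cts_div; [by rewrite gt_eqF | exact: cts_Im_at | exact: cts_Re_at].
Qed.

Lemma logR1 : logR 1 = 0.
Proof. by rewrite /logR cabs1 ln1 /= mul0r atan0. Qed.

Lemma near_one_Re z : cabs (z - 1) < 1 -> 0 < Re z.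
Proof.
move=> h; have := le_lt_trans (Re_cabs _) h; rewrite ReB /= ltr_norml => /andP[].
by move=> ? _; lra.
Qed.

Lemma cexp_surj z : z != 0 -> exists w, cexp w = z.
Proof.
move=> z0.
have H s : 0 < Re s -> exists w, cexp w = s by move=> h; exists (logR s); exact: logRK.
have Hm s : (exists w, cexp w = s) -> exists w, cexp w = - s.
  by case=> w e; exists (w + (0 +i* pi)); rewrite cexpD cexp_ipi e mulrN1.
have Hi s : (exists w, cexp w = s) -> exists w, cexp w = 'i * s.
  case=> w e; exists (w + (0 +i* (pi / 2))); rewrite cexpD e mulrC; congr (_ * _).
  by rewrite /cexp /= expR0 mul1r /cis cos_pihalf sin_pihalf.
have [h|h|h] := ltrgtP 0 (Re z); first exact: H.
  by rewrite -[z]opprK; apply: Hm; apply: H; rewrite ReN oppr_gt0.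
have z' : z = 'i * (Im z)%:C by apply: cplxP; rewrite /= -?h; ring.
have [k|k|k] := ltrgtP 0 (Im z).
- by rewrite z'; apply: Hi; exact: H.
- by rewrite -[z]opprK z' -mulrN; apply/Hm/Hi/H; rewrite ReN oppr_gt0.
- by case/eqP: z0; rewrite z' -k mulr0.
Qed.

(** A branch near [z0] is obtained from a logarithm of [z0] and from the principal
    logarithm of [z / z0], which is close to 1. *)
Lemma log_near z0 : z0 != 0 -> exists l : C -> C,
  \forall z \near z0, cts l z /\ cexp (l z) = z.
Proof.
move=> h; have [w ew] := cexp_surj h.
exists (fun z => w + logR (z / z0)).
have c0 z : cts (fun z : C => z / z0) z by apply/cts_mulr/cts_id.
have : nbhs z0 [set z : C | cabs (z / z0 - 1) < 1].
  apply: (cts_near (A := [set u : C | cabs (u - 1) < 1]) (c0 z0)).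
  by rewrite /= mulfV //; exact: nbhs_disc.
apply: filterS => z /near_one_Re hz; split.
  apply: cts_addl; apply: (@cts_comp _ _ _ _ logR (fun z : C => z / z0)) => //.
  exact: cts_logR.
by rewrite cexpD ew logRK // mulrC divfK.
Qed.

(** The values of [d] lie in [2 pi i Z]; by the intermediate value theorem [Im d]
    cannot leave a multiple of [2 pi] without taking other values. *)
Lemma cexp_eq1_const (d : R -> C) (a b : R) : a <= b ->
  {within `[a, b], continuous d} ->
  (forall t, a <= t <= b -> cexp (d t) = 1) -> d a = d b.
Proof.
move=> ab cd h.
have [ra _] := cexp_eq1 (h a ltac:(by rewrite lexx ab)).
have [rb _] := cexp_eq1 (h b ltac:(by rewrite lexx ab)).
apply: cplxP; first by rewrite ra rb.
have cI : {within `[a, b], continuous (fun t => Im (d t))}.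
  by move=> t; apply/ctsP; apply: (@cts_Im (subspace `[a, b]) t d); split; exact: cd.
apply/eqP; apply: contrapT => /negP ne.
set m := Num.min (Im (d a)) (Im (d b)).
set M := Num.max (Im (d a)) (Im (d b)).
have mM : m < M.
  by rewrite /m /M; case: (ltrgtP (Im (d a)) (Im (d b))) ne.
have mP : sin (m / 2) = 0.
  by rewrite /m; case: leP => _; apply: (cexp_eq1 (h _ _)).2; rewrite lexx ab.
set v := Num.min (m + 1) M.
have mv : m < v <= m + 1.
  by rewrite /v lt_min ge_min lexx mM /= andbT ltrDl ltr01.
have [|t] := @IVT R (fun t => Im (d t)) a b v ab cI.
  by rewrite -/m -/M (ltW (andP mv).1) /= /v ge_min lexx orbT.
rewrite in_itv /= => tab tv; have [_ sv] := cexp_eq1 (h t tab).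
rewrite tv in sv.
have := sin_gt0_pi (x := (v - m) / 2).
have p2 : 2 <= (pi : R) := pi_ge2 R.
move=> /(_ _) s0; have : 0 < sin ((v - m) / 2).
  by apply: s0; case/andP: mv => ? ?; apply/andP; split; lra.
have -> : (v - m) / 2 = v / 2 + (- (m / 2)) by field.
by rewrite sinD sv sinN mP; rewrite mul0r oppr0 mulr0 addr0 ltxx.
Qed.

End ComplexBasics.

(** * Logarithms of nonvanishing functions on the plane and on the punctured plane *)

Section PlaneLog.
Variable R : realType.
Notation C := (cplx R).
Implicit Types (z w : C) (x y t : R).

Lemma cts_segment z w t : cts (fun t : R => z + t%:C * (w - z) : C) t.
Proof. by apply/cts_addl/cts_mulr/cts_real/cts_id. Qed.

Lemma cexp_eq1_plane (d : C -> C) : (forall z, cts d z) ->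
  (forall z, cexp (d z) = 1) -> forall z w, d z = d w.
Proof.
move=> cd h z w.
have := @cexp_eq1_const R (fun t => d (z + t%:C * (w - z))) 0 1 ler01.
have -> : z + 0%:C * (w - z) = z by ring.
have -> : z + 1%:C * (w - z) = w by ring.
apply=> [|t _]; last exact: h.
apply/continuous_subspaceT/ctsT => t.
exact: cts_comp (cd _) (cts_segment _ _ _).
Qed.

Lemma Re_sign_const (q : C -> C) : (forall z, cts q z) ->
  (forall z, Re (q z) != 0) -> forall z w, 0 < Re (q z) -> 0 < Re (q w).
Proof.
move=> cq h z w zp; rewrite lt_neqAle eq_sym h /= leNgt; apply/negP => wn.
have := @IVT R (fun t => Re (q (z + t%:C * (w - z)))) 0 1 0 ler01.
have -> : z + 0%:C * (w - z) = z by ring.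
have -> : z + 1%:C * (w - z) = w by ring.
case=> [||t _ e].
- apply/continuous_subspaceT/ctsT => t; apply: cts_Re.
  exact: cts_comp (cq _) (cts_segment _ _ _).
- by rewrite ge_min le_max (ltW zp) (ltW wn) orbT.
- by have := h (z + t%:C * (w - z)); rewrite e eqxx.
Qed.

(** The square with vertices [+-r +- ri]; all that matters is that it is a
    compact set containing the disc of radius [r]. *)
Definition square (r : R) : set C := [set z | `|Re z| <= r /\ `|Im z| <= r].

Lemma square_compact (r : R) : compact (square r).
Proof.
have -> : square r = (fun p : R * R => (p.1 +i* p.2 : C)) @` (`[-r, r] `*` `[-r, r]).
  apply/seteqP; split=> [z [a b]|_ [[x y] /= [a b]] <-].
    by exists (Re z, Im z) => /=; [rewrite !in_itv /= -!ler_norml | case: (z)].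
  by move: a b; rewrite !in_itv /= -!ler_norml.
apply: continuous_compact; last by apply: compact_setX; exact: segment_compact.
apply/continuous_subspaceT/ctsT => p.
by apply: cts_complex; split; [exact: cvg_fst | exact: cvg_snd].
Qed.

Lemma disc_square r z : cabs z <= r -> square r z.
Proof. by move=> h; split; [apply: le_trans h; exact: Re_cabs | apply: le_trans h; exact: Im_cabs]. Qed.

Lemma uniform_ratio (H : C -> C) (r : R) : (forall z, cts H z) -> (forall z, H z != 0) ->
  exists2 d : R, 0 < d & forall z w, cabs z <= r -> cabs (w - z) < d ->
    cabs (H w / H z - 1) < 1.
Proof.
move=> cH nH.
pose P (d : R) (z : C) := forall w, cabs (w - z) < d -> cabs (H w / H z - 1) < 1.
have /compact_near_coveringP/(_ R (nbhs (0 : R)) P _) K := @square_compact r.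
have {}K : \forall d \near nbhs (0 : R), square r `<=` P d.
  apply: K.
  move=> z _; have m0 : 0 < cabs (H z) / 4 by rewrite divr_gt0 ?cabs_gt0.
  have [e e0 He] := (nbhsC _ _).1 (cts_near (cH z) (nbhs_disc (H z) m0)).
  have e2 : 0 < e / 2 by rewrite divr_gt0.
  exists ([set w | cabs (w - z) < e / 2], [set d : R | `|0 - d| < e / 2]).
    by split; [exact: nbhs_disc | apply/nbhs_normP; exists (e / 2)].
  case=> v d /= [hv hd] w hw; have hd' : d < e / 2.
    by move: hd; rewrite sub0r normrN; apply: le_lt_trans; exact: ler_norm.
  have Hv : cabs (H v - H z) < cabs (H z) / 4 by apply: He; lra.
  have Hw : cabs (H w - H z) < cabs (H z) / 4.
    apply: He; have -> : w - z = (w - v) + (v - z) by ring.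
    by apply: le_lt_trans (cabsD _ _) _; lra.
  have -> : H w / H v - 1 = (H w - H v) / H v by field.
  rewrite cabsM cabsV ltr_pdivrMr ?cabs_gt0 // mul1r.
  have -> : H w - H v = (H w - H z) + - (H v - H z) by ring.
  apply: le_lt_trans (cabsD _ _) _; rewrite cabsN.
  have := cabs_sub_ge (H z) (H v); rewrite (cabsB (H z)); lra.
move: K => /nbhs_normP[e /= e0 He]; exists (e / 2); first by rewrite divr_gt0.
move=> z w hz hw; apply: (He (e / 2)); last exact: hw.
  by rewrite /= sub0r normrN gtr0_norm ?divr_gt0 // ltr_pdivrMr // ltr_pMr // ltr1n.
exact: disc_square.
Qed.

(** On a disc the logarithm is the sum, along the radius, of the principal
    logarithms of the ratios of consecutive values: these ratios are close to 1
    once the radius is cut into sufficiently many pieces. *)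
Lemma disc_log (H : C -> C) (w0 : C) (r : R) : (forall z, cts H z) ->
  (forall z, H z != 0) -> cexp w0 = H 0 ->
  exists L : C -> C, L 0 = w0 /\
    forall z, cabs z <= r -> cts L z /\ cexp (L z) = H z.
Proof.
move=> cH nH e0; have [d d0 Hd] := uniform_ratio r cH nH.
have [N Nd] : exists N : nat, `|r| < N.+1%:R * d.
  exists (Num.truncn (`|r| / d)).
  by rewrite -ltr_pdivrMr // truncnS_gt.
have N0 : (N.+1%:R : C) != 0 by rewrite pnatr_eq0.
pose c (j : nat) : C := j%:R / N.+1%:R.
pose q j z := H (c j.+1 * z) / H (c j * z).
pose L k z := w0 + \sum_(j < k) logR (q j z).
have qP j z : (j < N.+1)%N -> cabs z <= r -> 0 < Re (q j z).
  move=> jN zr; apply: near_one_Re; apply: Hd.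
    have cj : cabs (c j) <= 1.
      rewrite /c cabsM cabsV -!(rmorph_nat (real_complex R)) !cabs_real !normr_nat.
      by rewrite ler_pdivrMr ?ltr0Sn // mul1r ler_nat ltnW.
    rewrite cabsM; apply: le_trans zr.
    by rewrite ler_piMl ?cabs_ge0.
  have -> : c j.+1 * z - c j * z = N.+1%:R^-1 * z.
    by rewrite -mulrBl /c -mulrBl -natrB // subSnn mul1r.
  rewrite cabsM cabsV -(rmorph_nat (real_complex R)) cabs_real normr_nat.
  rewrite mulrC ltr_pdivrMr ?ltr0Sn // mulrC.
  by apply: le_lt_trans Nd; apply: le_trans zr (ler_norm _).
have cq j z : cts (q j) z.
  have cH' k : cts (fun z => H (c k * z)) z.
    by apply: (cts_comp (cH _)); exact/cts_mull/cts_id.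
  exact: cts_div (nH _) (cH' j.+1) (cH' j).
have LP k z : (k <= N.+1)%N -> cabs z <= r ->
    cts (L k) z /\ cexp (L k z) = H (c k * z).
  move=> + zr; elim: k => [|k IH] kN.
    rewrite /L; split; last by rewrite big_ord0 addr0 e0 /c !mul0r.
    apply: (cts_ext (f := fun=> w0)); last exact: cts_cst.
    by move=> v; rewrite big_ord0 addr0.
  have [c1 c2] := IH (ltnW kN); have qk := qP k z kN zr.
  split; last first.
    rewrite /L big_ord_recr /= addrA cexpD -/(L k z) c2 logRK // /q mulrC divfK //.
  apply: (cts_ext (f := fun z => L k z + logR (q k z))).
    by move=> v; rewrite /L big_ord_recr /= addrA.
  exact: cts_add c1 (cts_comp (cts_logR qk) (cq _ _)).
exists (L N.+1); split.
  rewrite /L big1 ?addr0 // => j _; rewrite /q !mulr0 divff // logR1 //.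
by move=> z zr; have := LP N.+1 z (leqnn _) zr; rewrite /c divff // mul1r.
Qed.

(** The logarithms on discs, normalised at 0, agree on each ray by [cexp_eq1_const],
    so they glue. *)
Lemma plane_log (H : C -> C) : (forall z, cts H z) -> (forall z, H z != 0) ->
  exists L : C -> C, (forall z, cts L z) /\ forall z, cexp (L z) = H z.
Proof.
move=> cH nH; have [w0 e0] := cexp_surj (nH 0).
have /choice[L LP] := fun r => @disc_log H w0 r cH nH e0.
have same r r' z : cabs z <= r -> cabs z <= r' -> L r z = L r' z.
  move=> zr zr'.
  have cz (t : R) : `|t| <= 1 -> cabs (t%:C * z) <= cabs z.
    by move=> t1; rewrite cabsM cabs_real ler_piMl ?cabs_ge0.
  have := @cexp_eq1_const R (fun t => L r (t%:C * z) - L r' (t%:C * z)) 0 1 ler01.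
  have -> : 0%:C * z = 0 by ring.
have -> : 1%:C * z = z by ring.
rewrite (LP r).1 (LP r').1 subrr => h.
  apply/subr0_eq/esym/h.
    apply: continuous_in_subspaceT => t; rewrite inE /= in_itv /= => /andP[t0 t1].
    have h1 : cabs (t%:C * z) <= cabs z by apply: cz; rewrite ger0_norm.
    have c1 : cts (fun t : R => t%:C * z : C) t by apply/cts_mulr/cts_real/cts_id.
    apply/ctsP/cts_sub.
      apply: (cts_comp (g := L r) _ c1); exact: ((LP r).2 _ (le_trans h1 zr)).1.
    apply: (cts_comp (g := L r') _ c1); exact: ((LP r').2 _ (le_trans h1 zr')).1.
  move=> t /andP[t0 t1]; have h1 := cz t ltac:(by rewrite ger0_norm).
  rewrite cexpB ((LP r).2 _ (le_trans h1 zr)).2 ((LP r').2 _ (le_trans h1 zr')).2.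
  by rewrite divff.
exists (fun z => L (cabs z + 1) z); split=> [z|z].
  apply: (cts_near_eq (f := L (cabs z + 2))).
    apply: filterS (nbhs_disc z (ltr01)) => w /= h; apply: same; last by lra.
    by have := cabs_sub_ge w z; lra.
  by apply: ((LP _).2 z _).1; lra.
by apply: ((LP _).2 z _).2; lra.
Qed.

Lemma mod_2pi (y : R) : exists k : int, 0 <= y - k%:~R * (2 * pi) < 2 * pi.
Proof.
have p0 : 0 < 2 * (pi : R) by rewrite mulr_gt0 // pi_gt0.
exists (Num.floor (y / (2 * pi))).
have /andP[a b] := mem_rg1_floor (y / (2 * pi)).
rewrite subr_ge0 -ler_pdivlMr // a /= ltrBlDl.
by move: b; rewrite ltr_pdivrMr // mulrDl mul1r.
Qed.

Lemma cexp_eq1P z : cexp z = 1 -> exists k : int, z = k%:~R * @period R.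
Proof.
move=> /cexp_eq1[r s]; have [k /andP[a b]] := mod_2pi (Im z); exists k.
suff h : Im z - k%:~R * (2 * pi) = 0.
  apply: cplxP; rewrite -(rmorph_int (real_complex R)) /= ?r; first by ring.
  by rewrite mul0r addr0; apply/subr0_eq.
apply: contrapT => /eqP ne.
have := @sin_gt0_pi R ((Im z - k%:~R * (2 * pi)) / 2).
have -> : sin ((Im z - k%:~R * (2 * pi)) / 2) = 0.
  have : cexp (z - k%:~R * @period R) = 1.
    rewrite cexpB; have -> : cexp z = 1.
      apply: cplxP; rewrite /cexp r expR0 mul1r /=.
        have := cos_mulr2n (Im z / 2); rewrite -[_ *+ 2]mulr_natl mulrC divfK // cos2sin2 s; move=> ->; ring.
      by have := sin_mulr2n (Im z / 2); rewrite -[_ *+ 2]mulr_natl mulrC divfK // s mulr0 mul0rn.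
    suff -> : cexp (k%:~R * @period R) = 1 by rewrite divr1.
    have nk (n : nat) : cexp (n%:R * @period R) = 1.
      by elim: n => [|n IH]; rewrite ?mul0r ?cexp0 // -addn1 natrD mulrDl cexpD IH !mul1r cexp_period.
    by case: k {a b ne} => n; rewrite ?NegzE ?rmorphN /= ?mulNr ?cexpN nk ?invr1.
  case/cexp_eq1 => _ <-; rewrite ImB; congr (sin ((_ - _) / 2)).
  by rewrite -(rmorph_int (real_complex R)) /=; ring.
rewrite ltxx => /(_ _) h; suff : false by []; apply: h; apply/andP; split.
  by rewrite divr_gt0 // lt_neqAle eq_sym ne.
by rewrite ltr_pdivrMr // [pi * 2]mulrC.
Qed.

Lemma polar z : z != 0 -> exists2 t : R, 0 <= t <= 2 * pi & z = (cabs z)%:C * cis t.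
Proof.
move=> z0; have [w ew] := cexp_surj z0; have [k /andP[a b]] := mod_2pi (Im w).
exists (Im w - k%:~R * (2 * pi)); first by rewrite a ltW.
rewrite -{1}ew -{1}ew cabs_cexp /cexp; congr (_ * _).
have kE (n : nat) s : cis (s + n%:R * (2 * pi)) = cis s :> C.
  by elim: n => [|n IH]; rewrite ?mul0r ?addr0 // -addn1 natrD mulrDl addrA mul1r cis_2pi IH.
case: k {a b} => n; first by rewrite -{1}(subrK (n%:R * (2 * pi)) (Im w)) kE.
by rewrite NegzE rmorphN /= mulNr opprK kE.
Qed.

(** The function [h \o cexp] has a logarithm on the plane.  Its jump along a period
    is a constant, which can be computed on the circle of radius [rho]; when it is
    0 the logarithm descends to the punctured plane. *)
Lemma annular_log (h : C -> C) (rho : R) (l : R -> C) :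
  (forall z, z != 0 -> cts h z /\ h z != 0) ->
  0 < rho -> {within `[0, 2 * pi], continuous l} ->
  (forall t, 0 <= t <= 2 * pi -> h (rho%:C * cis t) = cexp (l t)) ->
  l (2 * pi) = l 0 ->
  exists u : C -> C, forall z, z != 0 -> cts u z /\ h z = cexp (u z).
Proof.
move=> hh r0 cl hl ll.
have [L [cL LE]] : exists L : C -> C, (forall z, cts L z) /\ forall w, cexp (L w) = h (cexp w).
  apply: plane_log => [w|w]; last exact: (hh _ (cexp_neq0 w)).2.
  exact: cts_comp (hh _ (cexp_neq0 w)).1 (cts_cexp_at w).
have D0 w : L (w + @period R) = L w.
  pose D v := L (v + @period R) - L v.
  have cD v : cts D v.
    apply: cts_sub; last exact: cL.
    by apply: (cts_comp (cL _)); exact/cts_addr/cts_id.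
  have ED1 v : cexp (D v) = 1 by rewrite cexpB !LE cexpD_period divff // (hh _ (cexp_neq0 v)).2.
  pose p t : C := ln rho +i* t.
  have Ep t : cexp (p t) = rho%:C * cis t by rewrite /cexp /= lnK.
  have : L (p 0) - l 0 = L (p (2 * pi)) - l (2 * pi).
    apply: (@cexp_eq1_const R (fun t => L (p t) - l t)).
    - by rewrite mulr_ge0 // pi_ge0.
    - move=> t; apply/ctsP/(@cts_sub (subspace `[0, 2 * pi]) t _ (fun t => L (p t)) l).
        split; apply: (@continuous_subspaceT _ _ _ (fun t => L (p t))).
        apply/ctsT => s; apply: (cts_comp (cL _)).
        by apply: cts_complex; [exact: cts_cst | exact: cts_id].
      by split; exact: cl.
    - by move=> t ht; rewrite cexpB LE Ep hl // divff // cexp_neq0.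
  rewrite ll => /addIr e.
  have pp : p (2 * pi) = p 0 + @period R by apply: cplxP => /=; rewrite ?addr0 ?add0r.
  by apply/subr0_eq; rewrite -/(D w) (cexp_eq1_plane cD ED1 w (p 0)) /D -pp -e subrr.
have Dk w (k : int) : L (w + k%:~R * @period R) = L w.
  have nk (n : nat) v : L (v + n%:R * @period R) = L v.
    by elim: n => [|n IH]; rewrite ?mul0r ?addr0 // -addn1 natrD mulrDl mul1r addrA D0.
  case: k => n; first exact: nk.
  by rewrite NegzE rmorphN /= mulNr -{2}(subrK (n.+1%:R * @period R) w) nk.
have LEE w w' : cexp w = cexp w' -> L w = L w'.
  move=> e; have /cexp_eq1P[k kE] : cexp (w - w') = 1 by rewrite cexpB e divff // cexp_neq0.
  by rewrite -(subrK w' w) kE addrC Dk.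
have /choice[lg lgP] : forall z : C, exists w, z != 0 -> cexp w = z.
  by move=> z; case: (eqVneq z 0) => [->|/cexp_surj[w <-]]; [exists 0 | exists w].
exists (fun z => L (lg z)) => z z0; split; last by rewrite LE lgP.
have [g gP] := log_near z0.
apply: (cts_near_eq (f := fun v => L (g v))).
  near=> v; have [_ gv] : cts g v /\ cexp (g v) = v by near: v.
  by apply: LEE; rewrite gv lgP // -gv cexp_neq0.
exact: cts_comp (cL _) (nbhs_singleton gP).1.
Unshelve. all: by end_near. Qed.

(** Divided by [cexp (w / 2)], the lift of such a square root to the plane would be a
    constant sign, whereas it changes sign along a period. *)
Lemma no_sqrt_punctured (s : C -> C) : 
  (forall z, z != 0 -> cts s z) ->
  ~ (forall z, z != 0 -> s z ^+ 2 = z).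
Proof.
move=> cs ss.
pose q w := s (cexp w) * cexp (- w / 2).
have q2 w : q w ^+ 2 = 1.
  by rewrite /q exprMn ss ?cexp_neq0 // cexp_half -cexpD addrN cexp0.
have q1 w : q w = 1 \/ q w = -1.
  by have /eqP := q2 w; rewrite sqrf_eq1 => /orP[]/eqP; [left|right].
have cq w : cts q w.
  apply: cts_mul; first exact: cts_comp (cs _ (cexp_neq0 w)) (cts_cexp_at w).
  exact/cts_cexp/cts_mulr/cts_opp/cts_id.
have qn w : Re (q w) != 0 by case: (q1 w) => ->; rewrite /= ?oppr_eq0 oner_eq0.
have qp w : q (w + @period R) = - q w.
  rewrite /q cexpD_period; have -> : - (w + @period R) / 2 = - w / 2 + - (0 +i* pi).
    have -> : @period R = 2 * (0 +i* pi).
      by rewrite /period; move: (pi : R) => p; apply: cplxP => /=; ring.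
    by field.
  by rewrite cexpD cexpN cexp_ipi invrN1 mulrN1 mulrN.
have h w : 0 < Re (q w) -> False.
  move=> p; have := Re_sign_const cq qn (w + @period R) p.
  by rewrite qp ReN oppr_gt0 ltNge ltW.
case: (q1 0) => e; first by apply: (h 0); rewrite e ltr01.
by apply: (h (0 + @period R)); rewrite qp e opprK ltr01.
Qed.

End PlaneLog.

(** * Winding of a map around a point, and orientation *)

Section Winding.
Variable R : realType.
Notation C := (cplx R).
Implicit Types (z w : C) (x y t : R) (g k : C -> C).

(** [g] winds [d] times around [g z0] along small circles around [z0]: the
    quotient of [g z - g z0] by [(z - z0) ^+ d] has a continuous logarithm on a
    punctured disc.  In contrast with a condition on circles, this form is
    visibly stable under composition and inversion. *)
Definition winds (d : nat) (g : C -> C) (z0 : C) : Prop :=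
  exists u : C -> C, \forall z \near z0, z != z0 ->
    cts u z /\ g z - g z0 = (z - z0) ^+ d * cexp (u z).

Lemma cexp_exp z n : cexp z ^+ n = cexp (n%:R * z).
Proof.
elim: n => [|n IH]; first by rewrite mul0r cexp0.
by rewrite exprS IH -cexpD -natr1; congr cexp; ring.
Qed.

Lemma winds_near d g k z0 :
  (\forall z \near z0, g z = k z) -> winds d g z0 -> winds d k z0.
Proof.
move=> e [u hu]; exists u; have e0 := nbhs_singleton e.
move: e hu; apply: filterS2 => z ez h zz; have [cu <-] := h zz.
by rewrite ez e0.
Qed.

Lemma winds_comp d e g k z0 : (\forall z \near z0, cts g z) ->
  winds d g z0 -> winds e k (g z0) -> winds (d * e) (k \o g) z0.
Proof.
move=> cg [u hu] [v hv].
exists (fun z => e%:R * u z + v (g z)).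
have gv := cts_near (nbhs_singleton cg) hv.
move: cg hu gv; apply: filterS3 => z cg hu hv' zz.
have [cu eu] := hu zz.
have gz : g z != g z0.
  by rewrite -subr_eq0 eu mulf_neq0 ?cexp_neq0 // expf_neq0 // subr_eq0.
have [cv ev] := hv' gz; split.
  by apply: cts_add; [exact: cts_mull | exact: (cts_comp cv cg)].
by rewrite /= ev eu exprMn -exprM cexp_exp cexpD mulrA.
Qed.

Lemma winds_inv g k z0 : (\forall w \near g z0, cts k w) ->
  (\forall w \near g z0, g (k w) = w) -> k (g z0) = z0 ->
  winds 1 g z0 -> winds 1 k (g z0).
Proof.
move=> ck gk k0 [u hu]; exists (fun w => - u (k w)).
have hk : \forall w \near g z0, k w != z0 ->
    cts u (k w) /\ g (k w) - g z0 = (k w - z0) ^+ 1 * cexp (u (k w)).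
  apply: (cts_near (A := fun z => z != z0 -> cts u z /\
    g z - g z0 = (z - z0) ^+ 1 * cexp (u z)) (nbhs_singleton ck)).
  by rewrite k0.
move: ck gk hk; apply: filterS3 => w ck gk hk ww.
have kw : k w != z0.
  by apply: contra ww => /eqP e; rewrite -gk e.
have [cu eu] := hk kw; split; first exact/cts_opp/(cts_comp cu ck).
by rewrite gk in eu; rewrite k0 cexpN expr1 eu expr1 mulfK ?cexp_neq0.
Qed.

Lemma cts_min (T : topologicalType) (p : T) (f h : T -> R) :
  cts f p -> cts h p -> cts (fun q => Num.min (f q) (h q)) p.
Proof. by case=> cf [ch]; split; exact: continuous_min. Qed.

(** A winding number 1 for [g z - g z0] means a winding number 0 for its quotient by
    [z - z0], to which [annular_log] applies. *)
Lemma oriented_winds g z0 : (\forall z \near z0, cts g z) ->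
  oriented_at g z0 -> winds 1 g z0.
Proof.
move=> /nbhsC[r1 r10 cg] [r2 r20 og].
set r := Num.min r1 r2; have r0 : 0 < r by rewrite lt_min r10.
set rho := r / 2; have rho0 : 0 < rho by rewrite divr_gt0.
have rho1 : rho < r by rewrite ltr_pdivrMr // ltr_pMr // ltr1n.
have [rho2 rho3] : rho < r1 /\ rho < r2.
  by move: rho1; rewrite lt_min => /andP[].
pose f z : C := g (z0 + z) - g z0.
have fP z : z != 0 -> cabs z < r2 -> f z != 0.
  move=> zn zr; have [|th [m [_ /(_ _)H _]]] := og (cabs z); first by rewrite cabs_gt0 zn.
  have [t ht zt] := polar zn; have [m0 e] := H t ht.
  rewrite /f {1}zt e mulf_neq0 ?cis_neq0 // -cabs_eq0 cabs_real normr_eq0 gt_eqF //.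
(* outside the disc of radius rho, h is constant along each ray, so that it is
   defined and continuous on the whole punctured plane *)
pose s z : R := Num.min 1 (rho / cabs z).
pose h z : C := f ((s z)%:C * z) / ((s z)%:C * z).
have sP z : z != 0 -> [/\ 0 < s z, cabs ((s z)%:C * z) <= rho & (s z)%:C * z != 0].
  move=> zn; have c0 : 0 < cabs z by rewrite cabs_gt0.
  have s0 : 0 < s z by rewrite lt_min ltr01 divr_gt0.
  split=> //; last by rewrite mulf_neq0 // -cabs_gt0 cabs_real normr_gt0 gt_eqF.
  by rewrite cabsM cabs_real gtr0_norm // -ler_pdivlMr // /s ge_min lexx orbT.
have s1 z : cabs z <= rho -> z != 0 -> s z = 1.
  move=> zr zn; rewrite /s; apply/min_idPl.
  by rewrite ler_pdivlMr ?cabs_gt0 // mul1r.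
have [] := og rho; first by rewrite rho0.
move=> th [m [cth H t2]].
pose c t : C := rho%:C * cis t.
have cabs_c t : cabs (c t) = rho.
  by rewrite cabsM cabs_cis mulr1 cabs_real gtr0_norm.
have c0 t : c t != 0 by rewrite -cabs_gt0 cabs_c.
have fc t : 0 < cabs (f (c t)) by rewrite cabs_gt0 fP // cabs_c.
pose l t : C := ln (cabs (f (c t)) / rho) +i* (th t - t).
have c2pi : c (2 * pi) = c 0 by rewrite /c -[2 * pi]add0r cis_2pi.
have [||||u uP] := @annular_log R h rho l _ rho0.
- move=> z zn; have [sz zs nz] := sP z zn; split; last first.
    by rewrite mulf_neq0 ?invr_neq0 // fP // (le_lt_trans zs).
  have cs : cts (fun z => (s z)%:C * z : C) z.
    apply: cts_mul; last exact: cts_id.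
    apply/cts_real/cts_min; first exact: cts_cst.
    by apply: cts_div; [rewrite cabs_eq0 | exact: cts_cst | exact: cts_cabs_at].
  apply: (cts_div (g := fun z => (s z)%:C * z) nz _ cs); rewrite /f; apply: cts_sub; last exact: cts_cst.
  apply: (cts_comp (g := g)); last exact: cts_addl.
  by apply: cg; rewrite addrC addKr (le_lt_trans zs).
- move=> t; apply/ctsP; apply: (@cts_complex _ (subspace `[0, 2 * pi])); last first.
    apply: (@cts_sub (subspace `[0, 2 * pi]) t _ th (fun t => t)).
      by split; exact: cth.
    by split; apply: (@continuous_subspaceT _ _ _ (fun t : R => t)) => s0; exact: cvg_id.
  split; apply: (@continuous_subspaceT _ _ _ (fun t => ln (cabs (f (c t)) / rho))).
  apply/ctsT => {}t; apply: (@cts_comp _ _ _ _ (@ln R) (fun t => cabs (f (c t)) / rho)).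
    by split; apply: continuous_ln; rewrite divr_gt0.
  apply/cts_mulr/cts_cabs/cts_sub; last exact: cts_cst.
  apply: (cts_comp (g := g)); last exact/cts_addl/cts_mull/cts_cis.
  by apply: cg; rewrite addrC addKr cabs_c.
- move=> t ht; have [m0 e] := H t ht.
  have -> : cexp (l t) = (m t / rho)%:C * cis (th t - t).
    have -> : m t = cabs (f (c t)).
      by rewrite /f e cabsM cabs_cis mulr1 cabs_real gtr0_norm.
    by rewrite /cexp /= lnK ?posrE ?divr_gt0.
  rewrite -/(c t) /h s1 ?cabs_c // mul1r /f e cisD.
  rewrite (_ : cis (- t) = (cis t)^-1); last first.
    by apply: (mulfI (cis_neq0 t)); rewrite -cisD subrr cis0 mulfV ?cis_neq0.
  rewrite fmorph_div /= /c; field.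
  by rewrite cis_neq0 /= -cabs_gt0 cabs_real normr_gt0 gt_eqF.
- by rewrite /l c2pi; congr (_ +i* _); have := t2; lra.
exists (fun z => u (z - z0)); apply/nbhsC; exists rho => // z zr zz.
have zn : z - z0 != 0 by rewrite subr_eq0.
have [cu eu] := uP _ zn; split.
  by apply: (cts_comp (f := fun z => z - z0) cu); exact/cts_addr/cts_id.
by rewrite -eu /h s1 ?(ltW zr) // mul1r /f expr1 mulrC divfK // [z0 + _]addrC subrK.
Qed.

Lemma winds_oriented g z0 : winds 1 g z0 -> oriented_at g z0.
Proof.
move=> [u /nbhsC[r r0 H]]; exists r => // rho /andP[p0 pr].
pose c t : C := z0 + rho%:C * cis t.
have cz t : c t - z0 = rho%:C * cis t by rewrite /c addrC addKr.
have cc t : cabs (c t - z0) = rho.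
  by rewrite cz cabsM cabs_cis mulr1 cabs_real gtr0_norm.
have cn t : c t != z0 by rewrite -subr_eq0 -cabs_gt0 cc.
have uP t := H (c t) ltac:(by rewrite cc) (cn t).
exists (fun t => t + Im (u (c t))), (fun t => rho * expR (Re (u (c t)))); split.
- apply/continuous_subspaceT/ctsT => t; apply: cts_add; first exact: cts_id.
  apply/cts_Im; apply: (cts_comp (g := u)); first exact: (uP t).1.
  exact/cts_addl/cts_mull/cts_cis.
- move=> t _; split; first by rewrite mulr_gt0 ?expR_gt0.
  rewrite -/(c t) (uP t).2 cz expr1 cisD rmorphM /= /cexp; ring.
- have -> : c (2 * pi) = c 0 by rewrite /c -[2 * pi]add0r cis_2pi.
  lra.
Qed.

End Winding.

(** * Charts of the Riemann sphere *)

Section Sphere.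
Variable R : realType.
Notation C := (cplx R).
Notation P := (P1 R).
Implicit Types (z w : C) (p q : P).

Lemma nbhs_Some z (A : set P) : nbhs (Some z : P) A <-> \forall w \near z, A (Some w).
Proof. by []. Qed.

Lemma nbhs_None (A : set P) : nbhs (None : P) A <->
  A None /\ exists M : R, forall z, M < cabs z -> A (Some z).
Proof.
split=> [[D [cD _] DA]|[AN [M HM]]].
  split; first by apply: DA; right.
  pose Q (M : R) z := cabs z <= M.
  have /compact_near_coveringP/(_ R (pinfty_nbhs R) Q _) K := cD.
  have {}K : \forall M \near +oo, D `<=` Q M.
    apply: K => z _; exists ([set w | cabs (w - z) < 1], [set M | cabs z + 1 < M]).
      split; first exact: nbhs_disc.
      by apply: nbhs_pinfty_gt; rewrite num_real.
    case=> w M /= [h1 h2]; rewrite /Q ltW //; apply: le_lt_trans h2.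
    by have := cabs_sub_ge w z; lra.
  have [M DM] := filter_ex K.
  exists M => z zM; apply: DA; left; exists z => //= Dz.
  by have := DM z Dz; rewrite /Q leNgt zM.
exists (square M).
  split; first exact: square_compact.
  by apply: compact_closed (@square_compact R M); exact: norm_hausdorff.
move=> p [[z /= nz <-]|->//]; apply: HM; rewrite ltNge; apply/negP => h.
exact: nz (disc_square h).
Qed.

Lemma P1_compact : compact [set: P].
Proof. exact: one_point_compactification_compact. Qed.

Lemma P1_hausdorff : hausdorff_space P.
Proof.
apply: one_point_compactification_hausdorff; last exact: norm_hausdorff.
move=> z _; exists (square (cabs z + 1)).
  apply: filterS (nbhs_disc z (@ltr01 R)) => w /= h _; apply: disc_square.
  by have := cabs_sub_ge w z; lra.
split; first exact: square_compact.
by apply: compact_closed (@square_compact R _); exact: norm_hausdorff.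
Qed.

Lemma P1_paramK p w : P1_coord p (P1_param p w) = w.
Proof. by case: p => [z|] //=; case: eqP => [->|_] //=; rewrite invrK. Qed.

Lemma P1_coordK p : P1_param p (P1_coord p p) = p.
Proof. by case: p => [z|] //=; rewrite eqxx. Qed.

(** The charts are homeomorphisms onto open sets; thus questions near a point of the
    sphere, infinity included, become questions in the plane. *)
Lemma nbhs_param p w (A : set P) :
  nbhs (P1_param p w) A <-> \forall v \near w, A (P1_param p v).
Proof.
case: p => [z|] //=; case: eqP => [->|/eqP w0].
  rewrite nbhs_None; split=> [[AN [M HM]]|/nbhsC[e e0 H]].
    apply/nbhsC; exists (`|M| + 1)^-1 => [|v]; first by rewrite invr_gt0; have := normr_ge0 M; lra.
    rewrite subr0; case: eqP => // /eqP v0 h; apply: HM; rewrite cabsV.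
    have c0 : 0 < cabs v by rewrite cabs_gt0.
    have := ler_norm M; have : `|M| + 1 < (cabs v)^-1.
      by rewrite -[`|M| + 1]invrK ltf_pV2 // posrE invr_gt0; have := normr_ge0 M; lra.
    lra.
  have h0 := H 0; rewrite subrr cabs0 eqxx in h0; split; first exact: h0.
  exists e^-1 => z zM; have z0 : z != 0.
    by rewrite -cabs_gt0 (lt_trans _ zM) // invr_gt0.
  have := H z^-1; rewrite subr0 invr_eq0 (negPf z0) invrK; apply.
  by rewrite cabsV -[e]invrK ltf_pV2 // posrE ?invr_gt0 // cabs_gt0.
have n0 : \forall v \near w, v != 0.
  apply/nbhsC; exists (cabs w); first by rewrite cabs_gt0.
  by move=> v; apply: contraTneq => ->; rewrite sub0r cabsN ltxx.
have cV (v : C) : v != 0 -> cts (fun v : C => v^-1) v.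
  by move=> v0; apply: cts_inv v0 _; exact: cts_id.
rewrite nbhs_Some; split=> h.
  have := cts_near (cV w w0) h; move: n0; apply: filterS2 => v v0 hv.
  by rewrite (negPf v0).
have wV : w^-1 != 0 by rewrite invr_eq0.
have := cts_near (cV w^-1 wV) (A := [set v : C | v != 0]).
have := cts_near (cV w^-1 wV)
  (A := fun v : C => A (if v == 0 then None else Some v^-1)).
rewrite /= !invrK => /(_ h) + /(_ n0); apply: filterS2 => v + v0.
by rewrite (negPf v0) invrK.
Qed.

Lemma nbhs_chart p (A : set P) :
  nbhs p A <-> \forall v \near P1_coord p p, A (P1_param p v).
Proof. by rewrite -nbhs_param P1_coordK. Qed.

Lemma cts_param p w : cts (P1_param p) w.
Proof. by split=> A /nbhs_param. Qed.

Lemma cts_coord p w : cts (P1_coord p) (P1_param p w).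
Proof.
split=> A; rewrite P1_paramK => hA.
change (nbhs (P1_param p w) (fun q => A (P1_coord p q))); apply/nbhs_param.
by apply: filterS hA => v; rewrite P1_paramK.
Qed.

Lemma near_paramK p : \forall q \near p, P1_param p (P1_coord p q) = q.
Proof.
apply/nbhs_chart; exists 1 => //= v _; by rewrite P1_paramK.
Qed.

Section Local.
Variable F : P -> P.

Lemma P1_local_coord p : P1_local F p (P1_coord p p) = P1_coord (F p) (F p).
Proof. by rewrite /P1_local P1_coordK. Qed.

Lemma near_local p : cts F p ->
  \forall w \near P1_coord p p, F (P1_param p w) = P1_param (F p) (P1_local F p w).
Proof.
move=> cF; have := cts_near cF (near_paramK (F p)) => /nbhs_chart.
by apply: filterS => w /esym.
Qed.

Lemma near_cts_local p : (\forall q \near p, cts F q) ->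
  \forall w \near P1_coord p p, cts (P1_local F p) w.
Proof.
move=> cF; have := near_local (nbhs_singleton cF); move/nbhs_chart : cF.
apply: filterS2 => w cF e.
apply: (cts_comp (g := P1_coord (F p)) (f := fun w => F (P1_param p w))).
  by rewrite e; exact: cts_coord.
exact: cts_comp cF (cts_param p w).
Qed.

End Local.

(** Preservation of orientation at [p], read in the charts at [p] and [F p]. *)
Definition turns_once (F : P -> P) p := winds 1 (P1_local F p) (P1_coord p p).

Lemma turns_once_near (F G : P -> P) p :
  (\forall q \near p, F q = G q) -> turns_once F p -> turns_once G p.
Proof.
move=> e; apply: winds_near; have e0 := nbhs_singleton e.
by move/nbhs_chart : e; apply: filterS => w; rewrite /P1_local e0 => ->.
Qed.

Lemma turns_once_comp (F G : P -> P) p : (\forall q \near p, cts F q) ->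
  turns_once F p -> turns_once G (F p) -> turns_once (G \o F) p.
Proof.
move=> cF tF tG; have e := near_local (nbhs_singleton cF).
apply: (@winds_near _ _ (P1_local G (F p) \o P1_local F p)).
  by apply: filterS e => w /= e; rewrite {1}/P1_local -e.
have := winds_comp (d := 1) (e := 1) (near_cts_local cF) tF.
by rewrite muln1; apply; rewrite P1_local_coord.
Qed.

Lemma turns_once_inv (F G : P -> P) p : cancel F G -> cancel G F ->
  (forall q, cts F q) -> (forall q, cts G q) ->
  turns_once F p -> turns_once G (F p).
Proof.
move=> FG GF cF cG tF.
have e := near_local (cF p).
have cG' : \forall q \near F p, cts G q by apply: filterS filterT => q _; exact: cG.
have e' := near_local (cG (F p)).
have ce := near_cts_local cG'; rewrite FG in e'.
have := @winds_inv _ (P1_local F p) (P1_local G (F p)) (P1_coord p p).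
rewrite P1_local_coord; apply=> //; last by rewrite P1_local_coord FG.
have := cts_near (nbhs_singleton ce); rewrite P1_local_coord FG.
move=> /(_ _ e); move: e'; apply: filterS2 => w e1 e2.
by rewrite -[LHS](P1_paramK (F p)) -e2 -e1 GF P1_paramK.
Qed.

End Sphere.

(** * Homeomorphisms of the sphere and markings *)

Section ClosedMap.
Variables (T U : topologicalType) (g : T -> U).
Hypotheses (cT : compact [set: T]) (hU : hausdorff_space U).
Hypothesis cg : forall x, cts g x.

(** The image of the complement of [A] is compact, hence closed. *)
Lemma near_fibre (A : set T) (y : U) : open A -> (forall x, g x = y -> A x) ->
  \forall v \near y, forall x, g x = v -> A x.
Proof.
move=> oA hA.
have cI : compact (g @` ~` A).
  apply: continuous_compact; first by apply/continuous_subspaceT/ctsT.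
  by apply: subclosed_compact cT _ => //; exact: open_closedC.
have oI : open (~` (g @` ~` A)) by apply: closed_openC; exact: compact_closed.
have : (~` (g @` ~` A)) y by move=> [x nx e]; exact: nx (hA x e).
move=> ny; have := open_nbhs_nbhs (conj oI ny); apply: filterS => v nv x e.
by apply: contrapT => nx; apply: nv; exists x.
Qed.

Lemma bijective_homeo (k : U -> T) : cancel g k -> cancel k g ->
  exists h : homeo T U, homeo_fun h = g /\ homeo_inv h = k.
Proof.
move=> gk kg.
have ck : continuous k.
  move=> y A; rewrite nbhsE => -[V [oV Vy] VA].
  have hV x : g x = y -> V x by move=> e; rewrite -(gk x) e.
  have := near_fibre oV hV.
  by apply: filterS => v hv; apply: VA; exact: hv (kg v).
by exists (Homeo gk kg ((ctsT g).2 cg) ck).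
Qed.

End ClosedMap.

Lemma cts_homeo (T U : topologicalType) (h : homeo T U) x : cts h x.
Proof. by split; exact: homeo_continuous. Qed.

Lemma cts_homeo_inv (T U : topologicalType) (h : homeo T U) y : cts (homeo_inv h) y.
Proof. by split; exact: homeo_inv_continuous. Qed.

Definition homeo_comp (T U V : topologicalType) (k : homeo U V) (h : homeo T U) :
  homeo T V.
Proof.
apply: (@Homeo _ _ (k \o h) (homeo_inv h \o homeo_inv k)).
- by move=> x /=; rewrite !homeoK.
- by move=> x /=; rewrite !homeo_invK.
- by apply/ctsT => x; apply: cts_comp; exact: cts_homeo.
- by apply/ctsT => x; apply: cts_comp; exact: cts_homeo_inv.
Defined.

Section WindsFactor.
Variable R : realType.
Notation C := (cplx R).

Lemma winds_factor d (g q : C -> C) (z0 : C) : q z0 != 0 ->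
  (\forall z \near z0, cts q z /\ g z - g z0 = (z - z0) ^+ d * q z) ->
  winds d g z0.
Proof.
move=> q0 h; have [l hl] := log_near q0; exists (fun z => l (q z)).
have := cts_near (nbhs_singleton h).1 hl; move: h.
apply: filterS2 => z [cq e] [cl el] _; split; last by rewrite el.
exact: (cts_comp (f := q) cl cq).
Qed.

Lemma winds_id (z0 : C) : winds 1 (fun z => z) z0.
Proof.
apply: (@winds_factor _ _ (fun=> 1)); first exact: oner_neq0.
apply: filterS filterT => z _; split; first exact: cts_cst.
by rewrite mulr1.
Qed.

End WindsFactor.

Section SphereMaps.
Variable R : realType.
Notation C := (cplx R).
Notation P := (P1 R).

Lemma cts_chart (T : topologicalType) (F : P -> T) p :
  cts F p <-> cts (fun w => F (P1_param p w)) (P1_coord p p).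
Proof.
split=> [cF|[cF]].
  by apply: cts_comp (cts_param p _); rewrite P1_coordK.
split=> A hA; change (nbhs p (fun q => A (F q))); apply/nbhs_chart.
by apply: cF; rewrite P1_coordK.
Qed.

Lemma cts_None_None (F : P -> P) : F None = None ->
  (forall M : R, exists N : R, forall z w, N < cabs z -> F (Some z) = Some w -> M < cabs w) ->
  cts F None.
Proof.
move=> F0 H; split=> A; rewrite F0 => /nbhs_None[AN [M HM]].
have [N HN] := H M; apply/nbhs_None; rewrite /preimage /= F0; split=> //.
by exists N => z /HN; case: (F (Some z)) => [w /(_ w erefl)/HM|].
Qed.

Definition oriented_homeo (T : homeo P P) : Prop := forall p, turns_once T p.

Lemma oriented_homeo_comp (T T' : homeo P P) :
  oriented_homeo T -> oriented_homeo T' -> oriented_homeo (homeo_comp T T').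
Proof.
move=> hT hT' p; apply: (@turns_once_comp _ T' T) => //.
by apply: filterS filterT => q _; exact: cts_homeo.
Qed.

Definition translate (c : C) (p : P) : P :=
  match p with Some z => Some (z + c) | None => None end.

Lemma translateK c : cancel (translate c) (translate (- c)).
Proof. by case=> [z|] //=; rewrite addrK. Qed.

Lemma cts_translate c p : cts (translate c) p.
Proof.
case: p => [z|].
  apply/cts_chart => /=; apply: (cts_comp (g := Some : C -> P) (f := fun z => z + c)).
    exact: (cts_param (Some 0)).
  exact/cts_addr/cts_id.
apply: cts_None_None => // M; exists (M + cabs c) => z w zM [<-].
by have := cabs_sub_ge z (- c); rewrite opprK cabsN; lra.
Qed.

Lemma translate_homeo c : exists T : homeo P P, oriented_homeo T /\
  forall p, T p = translate c p.
Proof.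
have K2 : cancel (translate (- c)) (translate c).
  by move=> p; have := translateK (- c) p; rewrite opprK.
have ct c' : continuous (translate c') by apply/ctsT; exact: cts_translate.
exists (Homeo (translateK c) K2 (ct c) (ct (- c))); split=> // -[z|] /=.
  apply: (@winds_factor _ _ _ (fun=> 1)); first exact: oner_neq0.
  apply: filterS filterT => w _; split; first exact: cts_cst.
  by rewrite /P1_local /=; ring.
apply: (@winds_factor _ _ _ (fun w => (1 + c * w)^-1)).
  by rewrite /= mulr0 addr0 invr1 oner_neq0.
have cq w : cts (fun w : C => 1 + c * w) w by exact/cts_addl/cts_mull/cts_id.
have : \forall w \near (0 : C), cabs (1 + c * w - 1) < 1.
  have := cts_near (A := [set v : C | cabs (v - 1) < 1]) (cq 0).
  by rewrite mulr0 addr0; apply; exact: nbhs_disc.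
apply: filterS => w /near_one_Re h; have nw : 1 + c * w != 0.
  by apply: contraTneq h => ->; rewrite ltxx.
split; first exact: cts_inv.
rewrite /P1_local /= eqxx /= !subr0 expr1.
case: eqP => [->|/eqP w0] /=; first by rewrite mul0r.
have -> : w^-1 + c = (1 + c * w) / w by field.
by rewrite invfM invrK mulrC.
Qed.

Definition inversion (p : P) : P :=
  match p with Some z => if z == 0 then None else Some z^-1 | None => Some 0 end.

Lemma inversionK : involutive inversion.
Proof.
case=> [z|] /=; last by rewrite eqxx.
by case: eqP => [->|/eqP z0] //=; rewrite invr_eq0 (negPf z0) invrK.
Qed.

Lemma inversion_homeo : exists T : homeo P P, oriented_homeo T /\
  forall p, T p = inversion p.
Proof.
have inv_param w : inversion (P1_param None w) = Some w.
  by rewrite /=; case: eqP => [->|/eqP w0] //=; rewrite invr_eq0 (negPf w0) invrK.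
have ci : continuous inversion.
  apply/ctsT => -[z|]; apply/cts_chart.
    exact: (cts_param None).
  by apply: (cts_ext (f := Some : C -> P)) (cts_param (Some 0) _) => w; rewrite inv_param.
exists (Homeo inversionK inversionK ci ci); split=> // -[z|]; rewrite /turns_once /=.
  have [->|z0] := eqVneq z 0.
    apply: winds_near (winds_id 0); apply: filterS filterT => w _.
    by rewrite /P1_local /= eqxx; case: eqP => [->|_] //=; rewrite invrK.
  apply: (@winds_factor _ _ _ (fun w => - (w * z)^-1)).
    by rewrite oppr_eq0 invr_eq0 mulf_neq0.
  have : \forall w \near z, w != 0.
    apply/nbhsC; exists (cabs z); first by rewrite cabs_gt0.
    by move=> v; apply: contraTneq => ->; rewrite sub0r cabsN ltxx.
  apply: filterS => w w0; split.
    by apply/cts_opp/cts_inv; [rewrite mulf_neq0 | exact/cts_mulr/cts_id].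
  rewrite /P1_local /= (negPf z0) (negPf w0) /=; field.
  by rewrite z0 w0.
apply: winds_near (winds_id 0); apply: filterS filterT => w _.
by rewrite /P1_local inv_param.
Qed.

(** Translations and the inversion suffice to move two points to 0 and infinity. *)
Lemma oriented_homeo_0oo (p q : P) : p <> q -> exists T : homeo P P,
  [/\ oriented_homeo T, T p = Some 0 & T q = None].
Proof.
have H z : exists T : homeo P P, [/\ oriented_homeo T, T (Some z) = Some 0 & T None = None].
  by have [T [oT TE]] := translate_homeo (- z); exists T; rewrite !TE /= subrr.
have [I [oI IE]] := inversion_homeo.
case: q => [z1|]; last by case: p => [z _|//]; exact: H.
move=> ne; have [T1 [hT1 h01 hoo1]] := H z1.
have [z2 h2] : exists z2, I (T1 p) = Some z2.
  rewrite IE; case e: (T1 p) => [v|] /=; last by exists 0.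
  have v0 : v != 0.
    apply: contra_notN ne => /eqP v0; rewrite v0 -h01 in e.
    by rewrite -(homeoK T1 p) e homeoK.
  by rewrite (negPf v0); exists v^-1.
have [T2 [hT2 h02 hoo2]] := H z2.
exists (homeo_comp T2 (homeo_comp I T1)); split.
- by apply: oriented_homeo_comp => //; exact: oriented_homeo_comp.
- by rewrite /= h2.
- by rewrite /= h01 IE /= eqxx.
Qed.

End SphereMaps.

Section Markings.
Variables (R : realType) (S : oriented_sphere R).
Notation C := (cplx R).
Notation P := (P1 R).
Local Notation ref := (sphere_ref S).

Lemma sphere_hausdorff : hausdorff_space S.
Proof.
move=> x y h; rewrite -(homeoK ref x) -(homeoK ref y); congr (homeo_inv _ _).
apply: P1_hausdorff => A B hA hB.
have [z [Az Bz]] := h _ _ (cts_near (cts_homeo ref x) hA) (cts_near (cts_homeo ref y) hB).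
by exists (ref z).
Qed.

Lemma sphere_compact : compact [set: S].
Proof.
have -> : [set: S] = homeo_inv ref @` [set: P].
  by apply/seteqP; split=> // x _; exists (ref x) => //; exact: homeoK.
apply: continuous_compact (@P1_compact R).
by apply/continuous_subspaceT; exact: homeo_inv_continuous.
Qed.

Lemma near_homeo_inv (h : homeo S P) x (A : set S) :
  nbhs x A -> \forall q \near h x, A (homeo_inv h q).
Proof.
by move=> hA; apply: (cts_near (cts_homeo_inv h (h x))); rewrite homeoK.
Qed.

Lemma near_cts_inv (T : topologicalType) (h : homeo S P) (g : S -> T) x :
  (\forall y \near x, cts g y) -> \forall q \near h x, cts (g \o homeo_inv h) q.
Proof.
move=> cg; apply: filterS (near_homeo_inv h cg) => q cq.
exact: cts_comp cq (cts_homeo_inv h q).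
Qed.

Lemma orientation_ref (g : S -> P) x : (\forall y \near x, cts g y) ->
  preserves_orientation_at g x <-> turns_once (g \o homeo_inv ref) (ref x).
Proof.
move=> cg; split; last exact: winds_oriented.
by apply: oriented_winds; exact: near_cts_local (near_cts_inv ref cg).
Qed.

(** A marking preserves orientation, hence so do the changes of coordinates between
    it and the reference homeomorphism. *)
Lemma orientation_marking (tau : marking S) (g : S -> P) x :
  (\forall y \near x, cts g y) ->
  preserves_orientation_at g x <-> turns_once (g \o homeo_inv tau) (tau x).
Proof.
move=> cg; rewrite orientation_ref //.
have ct : turns_once (tau \o homeo_inv ref) (ref x).
  apply/orientation_ref; last exact: marking_oriented.
  by apply: filterS filterT => y _; exact: cts_homeo.
have cti q : cts (tau \o homeo_inv ref) q.
  by apply: cts_comp; [exact: cts_homeo | exact: cts_homeo_inv].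
have cit q : cts (ref \o homeo_inv tau) q.
  by apply: cts_comp; [exact: cts_homeo | exact: cts_homeo_inv].
split=> h.
  have ct' : turns_once (ref \o homeo_inv tau) (tau x).
    have := turns_once_inv (G := ref \o homeo_inv tau) _ _ cti cit ct.
    by rewrite /= homeoK; apply=> q /=; rewrite !(homeoK, homeo_invK).
  have := turns_once_comp (F := ref \o homeo_inv tau) (G := g \o homeo_inv ref) _ ct'.
  rewrite /= homeoK => /(_ _ h) H.
  apply: turns_once_near (H _); last by apply: filterS filterT => q _; exact: cit.
  by apply: filterS filterT => q _ /=; rewrite homeoK.
have := turns_once_comp (F := tau \o homeo_inv ref) (G := g \o homeo_inv tau) _ ct.
rewrite /= homeoK => /(_ _ h) H.
apply: turns_once_near (H _); last by apply: filterS filterT => q _; exact: cti.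
by apply: filterS filterT => q _ /=; rewrite homeoK.
Qed.

Lemma marking_of_homeo (tau : marking S) (h : homeo S P) :
  (forall p, turns_once (h \o homeo_inv tau) p) ->
  exists psi : marking S, marking_homeo psi = h.
Proof.
move=> H; suff oh x : preserves_orientation_at h x by exists (Marking oh).
apply/(orientation_marking tau) => //.
by apply: filterS filterT => y _; exact: cts_homeo.
Qed.

Lemma marking_post (phi : marking S) (T : homeo P P) : oriented_homeo T ->
  exists psi : marking S, forall x, psi x = T (phi x).
Proof.
move=> oT; have [|psi e] := @marking_of_homeo phi (homeo_comp T phi).
  by move=> p; apply: turns_once_near (oT p); apply: filterS filterT => q _ /=; rewrite homeo_invK.
by exists psi => x; rewrite e.
Qed.

Lemma ref_marking : exists psi : marking S, marking_homeo psi = ref.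
Proof.
suff oh x : preserves_orientation_at ref x by exists (Marking oh).
apply/orientation_ref; first by apply: filterS filterT => y _; exact: cts_homeo.
apply: winds_near (winds_id _); apply: filterS filterT => w _.
by rewrite /P1_local /= !homeo_invK P1_paramK.
Qed.

Lemma marking_0oo (a b : S) : a <> b ->
  exists tau : marking S, tau a = Some 0 /\ tau b = None.
Proof.
move=> ab; have [psi e] := ref_marking.
have [|T [oT T0 Too]] := @oriented_homeo_0oo R (psi a) (psi b).
  by move=> h; apply: ab; rewrite -(homeoK psi a) h homeoK.
by have [tau tE] := marking_post psi oT; exists tau; rewrite !tE.
Qed.

End Markings.

(** * Fibres of a branched cover of degree two *)

Section Roots.
Variable R : realType.
Notation C := (cplx R).

Lemma root_exists (d : nat) (w : C) : (0 < d)%N -> exists v : C, v ^+ d = w.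
Proof.
move=> d0; have dn : (d%:R : C) != 0 by rewrite pnatr_eq0 -lt0n.
have [->|w0] := eqVneq w 0; first by exists 0; rewrite expr0n gtn_eqF.
have [l <-] := cexp_surj w0; exists (cexp (l / d%:R)).
by rewrite cexp_exp mulrC divfK.
Qed.

Definition zeta (d : nat) : C := cexp (@period R / d%:R).

Lemma zeta_exp d : (0 < d)%N -> zeta d ^+ d = 1.
Proof.
by move=> d0; rewrite cexp_exp mulrC divfK ?cexp_period // pnatr_eq0 -lt0n.
Qed.

Lemma zeta_neq1 d m : (0 < m < d)%N -> zeta d ^+ m != 1.
Proof.
move=> /andP[m0 md]; rewrite cexp_exp; apply/eqP => /cexp_eq1P[k].
have p0 : @period R != 0.
  apply/eqP => /(congr1 (@Im R)) /= /eqP; rewrite mulf_eq0 pnatr_eq0 /=.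
  by rewrite gt_eqF // pi_gt0.
have dn : (d%:R : C) != 0 by rewrite pnatr_eq0 -lt0n (leq_trans _ md).
rewrite mulrA [in LHS]mulrAC => /(mulIf p0) e.
have {}e : (m%:R : C) = k%:~R * d%:R by rewrite -e divfK.
have {}e : m%:Z = k * d%:Z.
  by apply: (@intr_inj C); rewrite intrM.
have : (d %| m)%N.
  by apply/dvdnP; exists `|k|%N; rewrite -[m]/(`|m%:Z|%N) e abszM.
by move/(dvdn_leq m0); rewrite leqNgt md.
Qed.

End Roots.

Section Charts.
Variables (R : realType) (S : oriented_sphere R).
Notation C := (cplx R).

Lemma disk_chart_inverse (x : S) (U : set S) (a : S -> C) : disk_chart x U a ->
  exists h : C -> S,
    (forall y, U y -> [/\ cts a y, cabs (a y) < 1 & h (a y) = y]) /\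
    (forall w, cabs w < 1 -> [/\ U (h w), a (h w) = w & cts h w]).
Proof.
move=> [oU Ux ax [[aU aI aS] ca [h [ch ha]]] _].
have diskE (w : C) : unit_disk R w <-> cabs w < 1.
  by rewrite /unit_disk /= cabsE -(rmorph1 (real_complex R)) ltcR.
have oD : open (unit_disk R).
  rewrite openE => w /diskE w1; apply/nbhsC; exists (1 - cabs w); first lra.
  by move=> v h1; apply/diskE; have := cabs_sub_ge v w; lra.
exists h; split=> [y Uy|w w1].
  split; [split|exact/diskE/aU|exact: ha].
  by move: ca; rewrite continuous_open_subspace //; apply; rewrite inE.
have [y Uy yw] := aS w ((diskE w).2 w1).
split; [by rewrite -yw ha|by rewrite -yw ha|split].
by move: ch; rewrite continuous_open_subspace //; apply; rewrite inE; apply/diskE.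
Qed.

End Charts.

Section BranchedCover.
Variables (R : realType) (S : oriented_sphere R) (f : S -> S).
Notation C := (cplx R).

Lemma sphere_separate (x y : S) : x <> y -> exists A B : set S,
  [/\ nbhs x A, nbhs y B & forall z, A z -> ~ B z].
Proof.
move=> /eqP xy; have := @sphere_hausdorff _ S.
rewrite open_hausdorff => /(_ _ _ xy)[[A B] /= [xA yB] [oA oB /eqP AB]].
rewrite !inE in xA yB; exists A, B.
split; [exact: open_nbhs_nbhs | exact: open_nbhs_nbhs | move=> z Az Bz].
by have : (A `&` B) z by []; rewrite AB.
Qed.

(** In the charts [f] is [z |-> z ^+ d]; the points [s i] are the [d]-th roots of the
    coordinate of [y]. *)
Lemma local_fibre (x : S) (d : nat) (N : set S) : local_degree f x d -> nbhs x N ->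
  \forall y \near f x, exists s : nat -> S,
    (forall i, N (s i) /\ f (s i) = y) /\
    (y <> f x -> forall i j, (i < j < d)%N -> s i <> s j).
Proof.
move=> [d0 [U [V [a [b [ch1 ch2 ab]]]]]] xN.
have [h [hU hD]] := disk_chart_inverse ch1.
have [k [kV kD]] := disk_chart_inverse ch2.
case: ch1 => _ Ux ax _ _; case: ch2 => oV Vx bx _ _.
have c01 : cabs (0 : C) < 1 by rewrite cabs0.
have [_ _ ch0] := hD 0 c01.
have h0 : h 0 = x by rewrite -ax; case: (hU x Ux).
have hN : nbhs (h 0) N by rewrite h0.
have [r0 r00 hr0] := (nbhsC _ _).1 (cts_near ch0 hN).
set r := Num.min r0 1.
have r_gt0 : 0 < r by rewrite lt_min r00 ltr01.
have hr w : cabs w < r -> cabs w < 1 /\ N (h w).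
  by rewrite lt_min => /andP[w0 w1]; split=> //; apply: hr0; rewrite subr0.
have [cb _ _] := kV _ Vx.
have nb : \forall y \near f x, cabs (b y) < r ^+ d.
  have := cts_near (A := [set w : C | cabs w < r ^+ d]) cb; rewrite bx; apply.
  by apply/nbhsC; exists (r ^+ d) => [|w]; rewrite ?exprn_gt0 // subr0.
have nV : nbhs (f x) V by exact: open_nbhs_nbhs.
move: nb nV; apply: filterS2 => y by1 Vy.
have [w0 ew0] := root_exists (b y) d0.
have zr : zeta R d ^+ d = 1 by exact: zeta_exp.
have cz i : cabs (zeta R d ^+ i) = 1.
  have cz1 : cabs (zeta R d) = 1.
    apply/eqP; rewrite -(@pexpr_eq1 _ _ d) ?cabs_ge0 // -?cabsX ?zr ?cabs1 //.
  by rewrite cabsX cz1 expr1n.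
have w0r : cabs w0 < r.
  by rewrite -(@ltr_pXn2r _ d) ?nnegrE ?cabs_ge0 ?ltW // -cabsX ew0.
have wr i : cabs (zeta R d ^+ i * w0) < r by rewrite cabsM cz mul1r.
exists (fun i => h (zeta R d ^+ i * w0)); split=> [i|yx i j /andP[ij jd] e].
  have [w1 Nw] := hr _ (wr i); split=> //.
  have [Uw aw _] := hD _ w1; have [Vf bf] := ab _ Uw.
  have [_ _ <-] := kV _ Vf; have [_ _ <-] := kV _ Vy; congr k.
  by rewrite bf aw exprMn -exprM mulnC exprM zr expr1n mul1r.
have [_ ai _] := hD _ (hr _ (wr i)).1; have [_ aj _] := hD _ (hr _ (wr j)).1.
have : zeta R d ^+ i * w0 = zeta R d ^+ j * w0 by rewrite -ai -aj e.
have wn : w0 != 0.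
  apply: contra_notN yx => /eqP w00; have [_ _ <-] := kV _ Vy.
  have -> : b y = b (f x) by rewrite bx -ew0 w00 expr0n gtn_eqF.
  by case: (kV _ Vx).
move/(mulIf wn); rewrite -(subnKC (ltnW ij)) exprD -{1}[_ ^+ i]mulr1.
have zn : zeta R d ^+ i != 0 by rewrite expf_neq0 // cexp_neq0.
move/(mulfI zn)/eqP; rewrite eq_sym; apply/negP/zeta_neq1.
by rewrite subn_gt0 ij /= (leq_ltn_trans (leq_subr _ _)).
Qed.

Hypotheses (fT : thurston_map f) (f2 : has_degree f 2).

Lemma cts_cover x : cts f x.
Proof. by split; exact: fT.1.1. Qed.

Lemma open_cover x (N : set S) : nbhs x N ->
  \forall y \near f x, exists2 z, N z & f z = y.
Proof.
move=> xN; have [d dx] := fT.1.2 x.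
apply: filterS (local_fibre dx xN) => y [s [hs _]].
by exists (s 0); have [] := hs 0.
Qed.

Lemma critical_value_post c : critical_points f c -> postcritical_set f (f c).
Proof. by move=> cc; exists 1%N => //; exists c. Qed.

Lemma regular_fibre y : ~ (f @` critical_points f) y ->
  exists a b, a <> b /\ forall x, f x = y <-> x = a \/ x = b.
Proof.
move=> /f2/card_set_bijP[g [g1 g2 g3]].
have [a /= fa ga] := g3 0%N isT; have [b /= fb gb] := g3 1%N isT.
exists a, b; split=> [e|x]; first by rewrite -e ga in gb.
split=> [fx|[->|->]] //.
have := g1 x fx => /=; case e: (g x) => [|[|n]] // _.
  by left; apply: g2; rewrite ?inE ?e ?ga.
by right; apply: g2; rewrite ?inE ?e ?gb.
Qed.

(** There are finitely many critical values, and the sphere has no isolated point. *)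
Lemma near_regular (y : S) (A : set S) : nbhs y A ->
  exists z, [/\ A z, z <> y & ~ (f @` critical_points f) z].
Proof.
move=> yA; set F := postcritical_set f `\` [set y].
have cF : closed F.
  apply: accessible_finite_set_closed.1.
    exact: hausdorff_accessible (@sphere_hausdorff _ S).
  exact: finite_setD fT.2.
have nF : nbhs y (~` F).
  by apply: open_nbhs_nbhs; split; [exact: closed_openC | move=> [_ []]].
pose ref := sphere_ref S.
have [e e0 H] := (nbhsC _ _).1 ((nbhs_chart _ _).1 (near_homeo_inv ref (filterI yA nF))).
set w0 := P1_coord (ref y) (ref y) in H.
have e2 : cabs (w0 + (e / 2)%:C - w0) < e.
  by rewrite addrC addKr cabs_real gtr0_norm ?divr_gt0 // ltr_pdivrMr // ltr_pMr // ltr1n.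
have [Az nFz] := H _ e2.
set z := homeo_inv ref _ in Az nFz.
have zy : z <> y.
  move=> zy; have : w0 + (e / 2)%:C = w0.
    by rewrite -[LHS](P1_paramK (ref y)) -[X in P1_coord _ X](homeo_invK ref) -/z zy.
  rewrite -{2}[w0]addr0 => /addrI /(congr1 (@Re R)) /= h.
  by have := divr_gt0 e0 (ltr0Sn R 1); rewrite h ltxx.
exists z; split=> // -[c cc fc]; apply: nFz; split=> //.
by rewrite -fc; exact: critical_value_post.
Qed.

(** Otherwise nearby regular fibres would have at least three points: two near [c]
    and one near another point of the fibre, or three near [c] if [d] exceeds 2. *)
Lemma critical_fibre c d : local_degree f c d -> (1 < d)%N ->
  d = 2%N /\ forall x, f x = f c -> x = c.
Proof.
move=> dc d1; split.
  have [y [[s [hs sI]] yc ny]] := near_regular (local_fibre dc (filterT)).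
  apply/eqP; rewrite eqn_leq d1 andbT leqNgt; apply/negP => d3.
  have [a [b [ab F]]] := regular_fibre ny.
  have sab i : s i = a \/ s i = b by apply/F; exact: (hs i).2.
  have := sI yc 0%N 1%N d1; have := sI yc 0%N 2%N d3; have := sI yc 1%N 2%N d3.
  by case: (sab 0%N) => ->; case: (sab 1%N) => ->; case: (sab 2%N) => ->.
move=> x fx; apply: contrapT => xc.
have [A [B [nA nB AB]]] := sphere_separate xc.
have h1 := open_cover nA; rewrite fx in h1.
have [y [[[s [hs sI]] [z Az fz]] yc ny]] := near_regular (filterI (local_fibre dc nB) h1).
have [a [b [ab F]]] := regular_fibre ny.
have sab i : s i = a \/ s i = b by apply/F; exact: (hs i).2.
have zab : z = a \/ z = b by apply/F.
have zs i : z <> s i by move=> e; apply: (AB z Az); rewrite e; exact: (hs i).1.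
have := sI yc 0%N 1%N d1; have := zs 0%N; have := zs 1%N.
by case: (sab 0%N) => ->; case: (sab 1%N) => ->; case: zab => ->.
Qed.

(** Regular fibres have two points and critical ones a single point; this gives the
    deck involution of [f]. *)
Lemma deck_exists : exists s : S -> S, forall x,
  (forall y, f y = f x <-> y = x \/ y = s x) /\ (s x = x <-> critical_points f x).
Proof.
have /choice[s sP] : forall x, exists x',
    (forall y, f y = f x <-> y = x \/ y = x') /\ (x' = x <-> critical_points f x).
  move=> x; case: (pselect ((f @` critical_points f) (f x))) => [[c [d d1 dc] fc]|nc].
    have [_ F] := critical_fibre dc d1.
    have xc : x = c by apply: F.
    exists x; split; last by split=> // _; exists d; rewrite // xc.
    by move=> y; split=> [e|[->|->]] //; left; rewrite xc; apply: F; rewrite e xc.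
  have [a [b [ab F]]] := regular_fibre nc.
  have ncx : ~ critical_points f x by move=> h; apply: nc; exists x.
  have [xa|xb] : x = a \/ x = b by apply/F.
    exists b; split=> [y|]; first by rewrite F xa.
    by split=> // e; case: ab; rewrite e xa.
  exists a; split=> [y|]; first by rewrite F xb; split=> -[]; auto.
  by split=> // e; case: ab; rewrite e xb.
by exists s.
Qed.

Section Deck.
Variable s : S -> S.
Hypothesis sP : forall x,
  (forall y, f y = f x <-> y = x \/ y = s x) /\ (s x = x <-> critical_points f x).

Lemma deck_fibre x y : f y = f x <-> y = x \/ y = s x.
Proof. exact: (sP x).1. Qed.

Lemma deck_f x : f (s x) = f x.
Proof. by apply/deck_fibre; right. Qed.

Lemma deckK x : s (s x) = x.
Proof.
have [e|//] : x = s x \/ x = s (s x) by apply/deck_fibre; rewrite deck_f.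
by rewrite -!e.
Qed.

(** At a regular point this is because [f] is open at the other point of the fibre,
    and at a critical point because nearby fibres are close to it, by compactness. *)
Lemma cts_deck x : cts s x.
Proof.
split=> A; rewrite nbhsE => -[V [oV Vsx] VA]; 
suff : nbhs x (s @^-1` V) by apply: filterS => y; exact: VA.
case: (pselect (s x = x)) => [sx|sx].
  rewrite sx in Vsx.
  have hV y : f y = f x -> V y by move=> /deck_fibre[->|->] //; rewrite sx.
  have := near_fibre (@sphere_compact _ S) (@sphere_hausdorff _ S) cts_cover oV hV.
  move/(cts_near (cts_cover x)); apply: filterS => y hy.
  by apply: hy; rewrite deck_f.
have [A1 [A2 [nA1 nA2 AB]]] := sphere_separate (nesym sx).
have n2 : nbhs (s x) (A2 `&` V) by apply: filterI => //; exact: open_nbhs_nbhs.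
have := open_cover n2; rewrite deck_f => /(cts_near (cts_cover x)).
move: nA1; apply: filterS2 => y A1y [z [A2z Vz] /deck_fibre[zy|zy]].
  by case: (AB y A1y); rewrite -zy.
by rewrite /preimage /= -zy.
Qed.

End Deck.
End BranchedCover.

(** * Double covers of the plane branched at the origin *)

Section Plane.
Variable R : realType.
Notation C := (cplx R).
Implicit Types (z w : C).

(** If [s] had no fixed point, [z - s z] would have a logarithm [u]; it changes
    sign under [s], so [u (s z) - u z] would be a constant [d] with [cexp d = -1],
    and applying [s] twice gives [d = - d]. *)
Lemma plane_involution_fixed (s : C -> C) : (forall z, cts s z) -> involutive s ->
  exists z, s z = z.
Proof.
move=> cs ss; apply: contrapT => nf.
have [|z|u [cu uE]] := @plane_log R (fun z => z - s z).
- by move=> z; apply: cts_sub => //; exact: cts_id.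
- by rewrite subr_eq0; apply/eqP => e; apply: nf; exists z.
pose d z := u (s z) - u z.
have cd z : cts d z by apply: cts_sub => //; exact: cts_comp (cu _) (cs z).
have Ed z : cexp (d z) = -1.
  rewrite cexpB !uE ss -[s z - z]opprB mulNr divff // subr_eq0.
  by apply/eqP => e; apply: nf; exists z.
have dc z : d z = d 0.
  apply/(addIr (- d 0)); rewrite subrr.
  have cc v : cts (fun z => d z - d 0) v by exact: cts_addr.
  rewrite (cexp_eq1_plane cc _ z 0) ?subrr // => v.
  by rewrite cexpB !Ed divff // oppr_eq0 oner_neq0.
have d0 : d 0 = 0.
  have : d (s 0) = - d 0 by rewrite /d ss opprB.
  rewrite dc => /eqP; rewrite -addr_eq0 -mulr2n -mulr_natl mulf_eq0 pnatr_eq0 /=.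
  by move/eqP.
have := Ed 0; rewrite d0 cexp0 => /eqP.
by rewrite -subr_eq0 opprK -mulr2n pnatr_eq0.
Qed.

(** In [beta \o g = alpha ^+ d] take the logarithm of [beta] to the other side. *)
Lemma winds_charts (d : nat) (g alpha beta : C -> C) z0 : (0 < d)%N ->
  (\forall z \near z0, cts g z) ->
  winds 1 alpha z0 -> winds 1 beta (g z0) -> alpha z0 = 0 -> beta (g z0) = 0 ->
  (\forall z \near z0, beta (g z) = alpha z ^+ d) -> winds d g z0.
Proof.
move=> d0 cg [u hu] [v hv] a0 b0 ab.
exists (fun z => d%:R * u z - v (g z)).
have gv := cts_near (nbhs_singleton cg) hv.
have cab : \forall z \near z0, cts g z /\ beta (g z) = alpha z ^+ d.
  by move: cg ab; apply: filterS2.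
move: hu gv cab; apply: filterS3 => z hu hv' [cz e] zz.
have [cu eu] := hu zz; rewrite a0 subr0 expr1 in eu.
have az : alpha z ^+ d != 0.
  by rewrite expf_neq0 // eu mulf_neq0 ?cexp_neq0 // subr_eq0.
have gz : g z != g z0 by apply: contra az => /eqP gz; rewrite -e gz b0.
have [cv ev] := hv' gz; split.
  by apply: cts_sub; [exact: cts_mull | exact: cts_comp cv cz].
rewrite b0 subr0 expr1 e eu exprMn cexp_exp in ev.
by rewrite cexpB mulrA ev mulfK // cexp_neq0.
Qed.

Section DoubleCover.
Variables g s : C -> C.
Hypotheses (cg : forall z, cts g z) (cs : forall z, cts s z).
Hypothesis og : forall z (N : set C), nbhs z N ->
  \forall w \near g z, exists2 v, N v & g v = w.
Hypothesis sg : forall w, exists z, g z = w.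
Hypothesis fibre : forall z w, g w = g z <-> w = z \/ w = s z.
Hypothesis g0 : forall z, g z = 0 <-> z = 0.
Hypothesis w2 : winds 2 g 0.

(** The quotient [g z / z ^+ 2] has winding number 0 around the origin; half of its
    logarithm is [u]. *)
Lemma double_cover_sqr : exists u : C -> C,
  forall z, z != 0 -> cts u z /\ g z = (z * cexp (u z)) ^+ 2.
Proof.
have gn z : z != 0 -> g z != 0 by apply: contra_neq => /g0.
have [u /nbhsC[r r0 H]] := w2.
set rho := r / 2; have rho0 : 0 < rho by rewrite divr_gt0.
pose c t : C := rho%:C * cis t.
have cabs_c t : cabs (c t) = rho.
  by rewrite cabsM cabs_cis mulr1 cabs_real gtr0_norm.
have c0 t : c t != 0 by rewrite -cabs_gt0 cabs_c.
have uP t : cts u (c t) /\ g (c t) = c t ^+ 2 * cexp (u (c t)).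
  have := H (c t); rewrite !subr0 (g0 0).2 // subr0; apply => //.
  by rewrite cabs_c ltr_pdivrMr // ltr_pMr // ltr1n.
have [||||k kP] := @annular_log R (fun z => g z / z ^+ 2) rho (fun t => u (c t)) _ rho0.
- move=> z z0; split; last by rewrite mulf_neq0 ?gn // invr_neq0 // expf_neq0.
  by apply: cts_div; [rewrite expf_neq0 | exact: cg | exact: cts_exp (@cts_id _ _)].
- apply/continuous_subspaceT/ctsT => t.
  by apply: (cts_comp (uP t).1); exact/cts_mull/cts_cis.
- by move=> t _; rewrite -/(c t) (uP t).2 mulrC mulKf // expf_neq0.
- by rewrite /c -[2 * pi]add0r cis_2pi.
exists (fun z => k z / 2) => z z0; have [ck ek] := kP z z0.
split; first exact: cts_mulr.
by rewrite exprMn cexp_half -ek mulrC divfK // expf_neq0.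
Qed.

Section SquareRoot.
Variable u : C -> C.
Hypothesis uP : forall z, z != 0 -> cts u z /\ g z = (z * cexp (u z)) ^+ 2.
Let psi z : C := z * cexp (u z).

Lemma root_sqr z : psi z ^+ 2 = g z.
Proof.
have [->|z0] := eqVneq z 0; last by rewrite (uP z0).2.
by rewrite /psi mul0r expr0n /=; apply/esym/g0.
Qed.

Lemma root_eq0 z : (psi z == 0) = (z == 0).
Proof. by rewrite mulf_eq0 (negPf (cexp_neq0 _)) orbF. Qed.

Lemma cts_root z : cts psi z.
Proof.
have [->|z0] := eqVneq z 0; last first.
  by apply: cts_mul; [exact: cts_id | exact: cts_cexp (uP z0).1].
split=> A; have -> : psi 0 = 0 by rewrite /psi mul0r.
move=> /nbhsC[e e0 H].
have e2 : 0 < e ^+ 2 by rewrite exprn_gt0.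
have := cts_near (cg 0) (nbhs_disc (g 0) e2); rewrite (g0 0).2 //.
apply: filterS => v /=; rewrite subr0 -root_sqr cabsX => h.
apply: H; rewrite subr0.
by rewrite -(@ltr_pXn2r _ 2) ?nnegrE ?cabs_ge0 // ltW.
Qed.

(** [psi \o s] and [psi] are square roots of the same function on a connected
    set, so they are equal or opposite; were they equal, [psi] would induce a
    continuous square root on the punctured plane. *)
Lemma root_deck z : psi (s z) = - psi z.
Proof.
have gs v : g (s v) = g v by apply/fibre; right.
have [->|z0] := eqVneq z 0.
  have -> : s 0 = 0 by apply/g0; rewrite gs; apply/g0.
  by rewrite /psi mul0r oppr0.
pose q w := psi (s (cexp w)) / psi (cexp w).
have q2 w : q w = 1 \/ q w = -1.
  have : q w ^+ 2 = 1.
    have ne : cexp w != 0 := cexp_neq0 w.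
    rewrite expr_div_n !root_sqr gs.
    by rewrite divff //; apply: contra ne => /eqP/g0/eqP.
  by move/eqP; rewrite sqrf_eq1 => /orP[]/eqP; [left|right].
have cq w : cts q w.
  apply: cts_div; first by rewrite root_eq0 cexp_neq0.
    by apply: (cts_comp (cts_root _)); apply: (cts_comp (cs _)); exact: cts_cexp_at.
  exact: cts_comp (cts_root _) (cts_cexp_at w).
have qn w : Re (q w) != 0 by case: (q2 w) => ->; rewrite /= ?oppr_eq0 oner_eq0.
have [w0 ew0] := cexp_surj z0.
have [e|e] := q2 w0; last first.
  move: e; rewrite /q ew0 => /(congr1 ( *%R^~ (psi z))).
  by rewrite divfK ?root_eq0 // mulN1r.
have q1 w : q w = 1.
  have [//|e'] := q2 w; have := Re_sign_const cq qn w (z := w0).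
  by rewrite e e' /= ltr01 => /(_ isT); rewrite ltrNr oppr0 ltNge ler01.
have ps v : v != 0 -> psi (s v) = psi v.
  move=> v0; have [w ew] := cexp_surj v0; have := q1 w; rewrite /q ew.
  by move/(congr1 ( *%R^~ (psi v))); rewrite divfK ?root_eq0 // mul1r.
have /choice[k kP] := sg.
exfalso; apply: (@no_sqrt_punctured R (psi \o k)) => w w_0; last first.
  by rewrite /= root_sqr kP.
split=> A /= hA.
have nk : k w != 0 by apply: contra w_0 => /eqP/g0; rewrite kP => ->.
have n0 : \forall v \near k w, v != 0.
  apply/nbhsC; exists (cabs (k w)); first by rewrite cabs_gt0.
  by move=> v; apply: contraTneq => ->; rewrite sub0r cabsN ltxx.
have nN : nbhs (k w) [set v | A (psi v) /\ v != 0].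
  have := cts_near (cts_root (k w)) hA; move: n0.
  by apply: filterS2 => v v0 Av; split.
have := og nN; rewrite kP.
apply: filterS => w' [v [Av v0] gv].
have /fibre[e'|e'] : g (k w') = g v by rewrite kP.
  by rewrite /preimage /= e'.
by rewrite /preimage /= e' ps.
Qed.

Lemma root_inj : injective psi.
Proof.
move=> z w e; have /fibre[//|ws] : g z = g w by rewrite -!root_sqr e.
move: e; rewrite ws root_deck => /eqP; rewrite eq_sym -addr_eq0 -mulr2n.
rewrite -mulr_natl mulf_eq0 pnatr_eq0 /= root_eq0 => /eqP w0.
have : psi z = 0 by rewrite ws root_deck w0 /psi mul0r oppr0.
by rewrite -ws w0 => /eqP; rewrite root_eq0 => /eqP.
Qed.

Lemma root_surj w : exists z, psi z = w.
Proof.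
have [z gz] := sg (w ^+ 2).
have /eqP : psi z ^+ 2 = w ^+ 2 by rewrite root_sqr.
rewrite eqf_sqr => /orP[]/eqP e; first by exists z.
by exists (s z); rewrite root_deck e opprK.
Qed.

(** Away from the branch point [psi] winds like [g], because
    [g z - g z0 = (psi z - psi z0) * (psi z + psi z0)]. *)
Lemma root_winds z0 : z0 != 0 -> winds 1 g z0 -> winds 1 psi z0.
Proof.
move=> z00 [v hv].
have p0 : psi z0 + psi z0 != 0.
  by rewrite -mulr2n -mulr_natl mulf_neq0 ?pnatr_eq0 // root_eq0.
have [l hl] := log_near p0.
have cp z : cts (fun z => psi z + psi z0) z by apply: cts_addr; exact: cts_root.
exists (fun z => v z - l (psi z + psi z0)).
have := cts_near (cp z0) hl; move: hv; apply: filterS2 => z hv [cl el] zz.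
have [cv ev] := hv zz; split.
  by apply: (cts_sub cv); exact: (cts_comp (f := fun z => psi z + psi z0) cl (cp z)).
rewrite cexpB mulrA -ev el -!root_sqr subr_sqr mulfK // -el cexp_neq0 //.
Qed.

Lemma root_winds0 : winds 1 psi 0.
Proof.
exists u; apply: filterS filterT => z _ z0; split; first exact: (uP z0).1.
by rewrite /psi mul0r !subr0 expr1.
Qed.

End SquareRoot.
End DoubleCover.
End Plane.

(** * The pullback of a marking *)

Section Pullback.
Variables (R : realType) (S : oriented_sphere R) (f : S -> S).
Notation C := (cplx R).
Notation P := (P1 R).
Hypotheses (fT : thurston_map f) (f2 : has_degree f 2).

Definition square_map (p : P) : P :=
  match p with Some z => Some (z ^+ 2) | None => None end.

Lemma critical_exists : postcritical_set f !=set0 -> exists c, critical_points f c.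
Proof. by move=> [_ [m _ [c cc _]]]; exists c. Qed.

Lemma planar_map (F : P -> P) : (forall p, cts F p) ->
  (forall z, F (Some z) <> None) ->
  exists g : C -> C, (forall z, cts g z) /\ forall z, F (Some z) = Some (g z).
Proof.
move=> cF nF.
pose g z := P1_coord (Some 0 : P) (F (Some z)).
have gE z : F (Some z) = Some (g z) by rewrite /g; case: (F (Some z)) (nF z).
exists g; split=> // z; apply: (cts_comp (g := P1_coord (Some 0 : P)) (f := fun z => F (Some z))).
  by rewrite gE; exact: (cts_coord (Some 0)).
by apply: (cts_comp (g := F)) (cF _) _; exact: (cts_param (Some 0)).
Qed.

Variable s : S -> S.
Hypothesis sP : forall x,
  (forall y, f y = f x <-> y = x \/ y = s x) /\ (s x = x <-> critical_points f x).

(** The complement of a single critical point would be a plane on which the deck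
    involution has no fixed point. *)
Lemma two_critical_points : postcritical_set f !=set0 ->
  exists c1 c2, [/\ c1 <> c2, critical_points f c1 & critical_points f c2].
Proof.
move=> /critical_exists[c cc]; apply: contrapT => only.
have cE x : critical_points f x -> x = c.
  by move=> cx; apply: contrapT => ne; apply: only; exists x, c.
have [a ac] : exists a, a <> c.
  pose h := homeo_inv (sphere_ref S).
  case: (pselect (h None = c)) => e; last by exists (h None).
  exists (h (Some 0)) => e'; have : h None = h (Some 0) by rewrite e e'.
  by move/(congr1 (sphere_ref S)); rewrite !homeo_invK.
have [tau [_ tc]] := marking_0oo ac.
pose F := tau \o s \o homeo_inv tau.
have cF p : cts F p.
  apply: (cts_comp (cts_homeo tau _)); apply: cts_comp (cts_homeo_inv tau p).
  exact: (cts_deck fT sP).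
have sc : s c = c by apply/(sP c).2.
have [z|g [cg gE]] := planar_map cF.
  rewrite -tc /F /= => /(congr1 (homeo_inv tau)); rewrite !homeoK => e.
  have : homeo_inv tau (Some z) = c by rewrite -(deckK sP (homeo_inv tau _)) e sc.
  by move/(congr1 tau); rewrite homeo_invK tc.
have gg : involutive g.
  move=> z; have : Some (g (g z)) = Some z :> P.
    by rewrite -!gE /F /= homeoK (deckK sP) homeo_invK.
  by case.
have [z gz] := plane_involution_fixed cg gg.
have /(sP _).2/cE : s (homeo_inv tau (Some z)) = homeo_inv tau (Some z).
  by apply: (can_inj (homeoK tau)); rewrite homeo_invK; have := gE z; rewrite /F /= gz.
by move/(congr1 tau); rewrite homeo_invK tc.
Qed.

(** The charts that define the local degree preserve orientation, and so do the
    markings, so [winds_charts] applies. *)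
Lemma winds_cover (tau phi : marking S) (g : C -> C) (z0 : C) (d : nat) :
  (forall z, cts g z) ->
  (forall z, phi (f (homeo_inv tau (Some z))) = Some (g z)) ->
  local_degree f (homeo_inv tau (Some z0)) d -> winds d g z0.
Proof.
move=> cg gE [d0 [U [V [a [b [ch1 ch2 ab]]]]]].
set x := homeo_inv tau (Some z0) in ch1 ch2.
have tx : tau x = Some z0 by rewrite homeo_invK.
have px : phi (f x) = Some (g z0) by rewrite gE.
have chart_winds (t : marking S) y W (c : S -> C) w0 : disk_chart y W c ->
    t y = Some w0 -> winds 1 (fun w => c (homeo_inv t (Some w))) w0.
  move=> ch ty; have [h [hW _]] := disk_chart_inverse ch.
  case: ch => oW Wy _ _ orient.
  have cc : \forall v \near y, cts (fun z => Some (c z) : P) v.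
    apply: filterS (open_nbhs_nbhs (conj oW Wy)) => v /hW[cv _ _].
    by apply: (cts_comp (g := Some : C -> P)) cv; exact: (cts_param (Some 0)).
  have := (orientation_marking t cc).1 (orient y Wy).
  by rewrite ty.
have xinv : homeo_inv tau (Some z0) = x by [].
have pinv : homeo_inv phi (Some (g z0)) = f x by rewrite -px homeoK.
apply: (winds_charts d0 _ (chart_winds tau x U a z0 ch1 tx) (chart_winds phi _ V b _ ch2 px)).
- by apply: filterS filterT => z _; exact: cg.
- by case: ch1.
- by rewrite pinv; case: ch2.
have nU : nbhs x U by case: ch1 => oU Ux _ _ _; exact: open_nbhs_nbhs.
have := near_homeo_inv tau nU; rewrite tx => /nbhs_Some; apply: filterS => z Uz.
by have [_ <-] := ab _ Uz; rewrite -gE homeoK.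
Qed.

Section TwoCritical.
Variables c1 c2 : S.
Hypotheses (c12 : c1 <> c2) (cc1 : critical_points f c1) (cc2 : critical_points f c2).

Lemma critical_fibre1 c x : critical_points f c -> f x = f c -> x = c.
Proof. by move=> [d d1 dc]; apply: (critical_fibre fT f2 dc d1).2. Qed.

(** In the coordinate [tau], where the critical points are 0 and infinity, [phi \o f]
    is a double cover of the plane branched at 0, and [psi] is its square root. *)
Lemma root_marking (phi : marking S) : phi (f c1) = Some 0 -> phi (f c2) = None ->
  exists psi : marking S, forall x, phi (f x) = square_map (psi x).
Proof.
move=> p1 p2; have [tau [t1 t2]] := marking_0oo c12.
have ti1 : homeo_inv tau (Some 0) = c1 by rewrite -t1 homeoK.
have ti2 : homeo_inv tau None = c2 by rewrite -t2 homeoK.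
have tinj p q : homeo_inv tau p = homeo_inv tau q -> p = q.
  by move/(congr1 tau); rewrite !homeo_invK.
pose F := phi \o f \o homeo_inv tau.
have cF p : cts F p.
  apply: (cts_comp (cts_homeo phi _)); apply: cts_comp (cts_homeo_inv tau p).
  exact: (cts_cover fT).
have FN p : F p = None -> p = None.
  move=> e; apply: tinj; rewrite ti2; apply: critical_fibre1 => //.
  by apply: (can_inj (homeoK phi)); rewrite p2.
have [z|g [cg gE]] := planar_map cF; first by move/FN.
pose G := tau \o s \o homeo_inv tau.
have cG p : cts G p.
  apply: (cts_comp (cts_homeo tau _)); apply: cts_comp (cts_homeo_inv tau p).
  exact: (cts_deck fT sP).
have sc2 : s c2 = c2 by apply/(sP c2).2.
have [z|r [cr rE]] := planar_map cG.
  rewrite -t2 /G /= => /(congr1 (homeo_inv tau)); rewrite !homeoK => e.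
  have : homeo_inv tau (Some z) = c2 by rewrite -(deckK sP (homeo_inv tau _)) e sc2.
  by rewrite -ti2 => /tinj.
have rS z : s (homeo_inv tau (Some z)) = homeo_inv tau (Some (r z)).
  by rewrite -rE /G /= homeoK.
have fibre z w : g w = g z <-> w = z \/ w = r z.
  have -> : g w = g z <-> f (homeo_inv tau (Some w)) = f (homeo_inv tau (Some z)).
    split=> [e|e]; last by have : F (Some w) = F (Some z); [rewrite /F /= e | rewrite !gE => -[]].
    by apply: (can_inj (homeoK phi)); have := gE w; rewrite /F /= => ->; rewrite e -gE.
  rewrite (deck_fibre sP) rS; split.
    by case=> /tinj[]; [left | right].
  by case=> ->; [left | right].
have g0 z : g z = 0 <-> z = 0.
  split=> [e|->]; last by have := gE 0; rewrite /F /= ti1 p1 => -[].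
  have := gE z; rewrite e /F /= -p1 => /(congr1 (homeo_inv phi)); rewrite !homeoK.
  by move/(critical_fibre1 cc1); rewrite -ti1 => /tinj[].
have og z (N : set C) : nbhs z N -> \forall w \near g z, exists2 v, N v & g v = w.
  move=> zN.
  have h1 : nbhs (homeo_inv tau (Some z)) (fun y => exists2 v, N v & tau y = Some v).
    have := cts_near (A := [set p : P | exists2 v, N v & p = Some v])
      (cts_homeo tau (homeo_inv tau (Some z))).
    rewrite homeo_invK; apply; apply/nbhs_Some; by apply: filterS zN => v Nv; exists v.
  have := near_homeo_inv phi (open_cover fT h1).
  rewrite -[phi _]/(F (Some z)) gE => /nbhs_Some; apply: filterS => w [y [v Nv ty] fy].
  exists v => //; have := gE v; rewrite /F /= -ty homeoK fy homeo_invK.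
  by case.
have sg w : exists z, g z = w.
  have [y fy] : exists y, f y = homeo_inv phi (Some w).
    case: (pselect ((f @` critical_points f) (homeo_inv phi (Some w)))) => [[y _ fy]|/(regular_fibre f2)[a [b [_ H]]]].
      by exists y.
    by exists a; apply/H; left.
  have pf : phi (f y) = Some w by rewrite fy homeo_invK.
  have := cF (tau y); case ty: (tau y) => [z|] _.
    exists z; have := gE z; rewrite /F /= -ty homeoK pf.
    by case.
  have yc : y = c2 by rewrite -ti2 -ty homeoK.
  by rewrite yc p2 in pf.
have w2 : winds 2 g 0.
  case: (cc1) => d d1 dc; have [d2 _] := critical_fibre fT f2 dc d1.
  by rewrite -d2; apply: (@winds_cover tau phi g 0 d) => //; rewrite ti1.
have [u uP] := double_cover_sqr cg g0 w2.
pose psi z := z * cexp (u z).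
have psi2 z : psi z ^+ 2 = g z := root_sqr g0 uP z.
have cpsi z : cts psi z := cts_root cg g0 uP z.
have inj : injective psi := root_inj cg cr og sg fibre g0 uP.
have surj w : exists z, psi z = w := root_surj cg cr og sg fibre g0 uP w.
have /choice[k kP] := surj.
have kK z : k (psi z) = z by apply: inj; rewrite kP.
pose Psi (p : P) : P := match p with Some z => Some (psi z) | None => None end.
pose K (p : P) : P := match p with Some z => Some (k z) | None => None end.
have sqPsi p : square_map (Psi p) = F p.
  case: p => [z|] /=; first by rewrite psi2 gE.
  by rewrite /F /= ti2 p2.
have cPsi p : cts Psi p.
  case: p => [z|].
    by apply/cts_chart; apply: (cts_comp (g := Some : C -> P)) (cpsi z); exact: (cts_param (Some 0)).
  apply: cts_None_None => // M.
  pose A := [set p : P | forall w, p = Some w -> (`|M| + 1) ^+ 2 < cabs w].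
  have nA : nbhs (F None) A.
    rewrite /F /= ti2 p2; apply/nbhs_None; split=> //.
    by exists ((`|M| + 1) ^+ 2) => z zM w [<-].
  have /nbhs_None[_ [N HN]] := cts_near (cF None) nA.
  exists N => z w zN [<-].
  have := HN z zN (g z) (gE z); rewrite -psi2 cabsX.
  have M0 := normr_ge0 M; have M1 := ler_norm M.
  rewrite ltr_pXn2r ?nnegrE ?cabs_ge0 //; lra.
have [|p|h [hE hI]] := @bijective_homeo P P Psi (@P1_compact R) (@P1_hausdorff R) cPsi K.
- by case=> [z|] //=; rewrite kK.
- by case: p => [z|] //=; rewrite kP.
have oh : oriented_homeo h.
  move=> p; apply: (@turns_once_near _ Psi); first by rewrite hE; apply: filterS filterT.
  case: p => [z|].
    have [->|z0] := eqVneq z 0; first exact: (root_winds0 uP).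
    apply: (root_winds cg g0 uP z0).
    have [d dx] := fT.1.2 (homeo_inv tau (Some z)).
    suff d1 : d = 1%N by rewrite d1 in dx; exact: winds_cover cg gE dx.
    apply/eqP; rewrite eqn_leq; case: (dx) => -> _; rewrite andbT leqNgt.
    apply/negP => d1; have : s (homeo_inv tau (Some z)) = homeo_inv tau (Some z).
      by apply/(sP _).2; exists d.
    rewrite rS => /tinj[rz]; have := root_deck cg cr og sg fibre g0 uP z.
    rewrite rz => /eqP; rewrite -addr_eq0 -mulr2n -mulr_natl mulf_eq0 pnatr_eq0 /=.
    by rewrite (root_eq0 u) (negPf z0).
  exists (fun w => - u w^-1); apply: filterS filterT => w _ w0 /=; split.
    have wV : w^-1 != 0 by rewrite invr_eq0.
    apply: cts_opp; apply: (cts_comp (f := fun w : C => w^-1) (uP _ wV).1).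
    by apply: cts_inv w0 _; exact: cts_id.
  rewrite /P1_local /= (negPf w0) eqxx /= !subr0 expr1 cexpN /psi invfM invrK //.
have [psi' psiE] := marking_post tau oh.
exists psi' => x; rewrite psiE hE sqPsi /F /= homeoK //.
Qed.

End TwoCritical.

Lemma holomorphic_square : holomorphic square_map.
Proof.
have dsq (z : C) : derivable (fun w : C => w ^+ 2) z 1.
  exact: (@exprn_derivable (cplx R)).
move=> p; split.
  apply/ctsP; case: p => [z|].
    apply/cts_chart; apply: (cts_comp (g := Some : C -> P) (f := fun z : C => z ^+ 2 : C)).
      exact: (cts_param (Some 0)).
    exact: cts_exp (@cts_id _ _).
  apply: cts_None_None => // M; exists (`|M| + 1) => z w zM [<-].
  have M0 := normr_ge0 M; have M1 := ler_norm M.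
  have c1 : 1 <= cabs z by lra.
  by rewrite cabsX expr2; apply: (lt_le_trans (y := cabs z)); [lra | rewrite ler_peMl ?cabs_ge0].
case: p => [z|]; first exact: dsq.
have -> : P1_local square_map None = (fun w => w ^+ 2); last exact: dsq.
apply/funext => w; rewrite /P1_local /=; case: eqP => [->|/eqP w0] /=.
  by rewrite expr0n.
by rewrite exprVn invrK.
Qed.

Lemma holomorphic_pullback (phi psi : marking S) :
  (forall x, phi (f x) = square_map (psi x)) ->
  holomorphic (phi \o f \o homeo_inv psi).
Proof.
move=> h; have -> : phi \o f \o homeo_inv psi = square_map; last exact: holomorphic_square.
by apply/funext => p /=; rewrite h homeo_invK.
Qed.

End Pullback.

(** * A homeomorphism supported in a disc *)

Section Bump.
Variable R : realType.
Notation C := (cplx R).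
Notation P := (P1 R).
Variables (eps r : R) (z0 : C).
Hypotheses (eps01 : 0 < eps < 1) (r0 : 0 < r).
Implicit Types z w : C.

Definition tent z : R := Num.max 0 (r - cabs (z - z0)).

(** A displacement of slope less than 1, so that the difference quotients of [push]
    stay in the disc of centre 1 and radius 1 ([push_slope]): this gives both
    injectivity and preservation of orientation. *)
Definition push z : C := z + (eps * tent z)%:C.

Definition push_map (p : P) : P :=
  match p with Some z => Some (push z) | None => None end.

Lemma tent_ge0 z : 0 <= tent z.
Proof. by rewrite le_max lexx. Qed.

Lemma tent_le z : tent z <= r.
Proof. by rewrite ge_max (ltW r0) /= gerBl cabs_ge0. Qed.

Lemma tent_out z : r <= cabs (z - z0) -> tent z = 0.
Proof. by move=> h; apply/max_idPl; rewrite subr_le0. Qed.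

Lemma push_out z : r <= cabs (z - z0) -> push z = z.
Proof. by move=> h; rewrite /push tent_out // mulr0 rmorph0 addr0. Qed.

Lemma push_center : push z0 = z0 + (eps * r)%:C.
Proof.
rewrite /push /tent subrr cabs0 subr0; congr (_ + (_ * _)%:C).
by apply/max_idPr; exact: ltW.
Qed.

Lemma tent_lipschitz z w : `|tent z - tent w| <= cabs (z - w).
Proof.
have h1 := cabs_sub_ge (z - z0) (w - z0); have h2 := cabs_sub_ge (w - z0) (z - z0).
have e1 : z - z0 - (w - z0) = z - w by ring.
have e2 : w - z0 - (z - z0) = w - z by ring.
rewrite e1 in h1; rewrite e2 (cabsB w z) in h2.
have h3 := cabs_ge0 (z - w).
rewrite /tent ler_norml; apply/andP.
by case: (leP 0 (r - cabs (z - z0))) => ?; case: (leP 0 (r - cabs (w - z0))) => ?; split; lra.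
Qed.

Lemma cts_tent z : cts tent z.
Proof.
apply/nbhsRP => e e0; apply/nbhsC; exists e => // w h.
by apply: le_lt_trans (tent_lipschitz _ _) _; rewrite cabsB.
Qed.

Lemma cts_push z : cts push z.
Proof.
apply: cts_add; first exact: cts_id.
by apply/cts_real/cts_mull; exact: cts_tent.
Qed.

Lemma push_slope z w : z != w -> let q := (push z - push w) / (z - w) in
  cabs (q - 1) < 1.
Proof.
move=> zw /=; have zw0 : z - w != 0 by rewrite subr_eq0.
have -> : (push z - push w) / (z - w) - 1 = (eps * (tent z - tent w))%:C / (z - w).
  by rewrite /push !rmorphM rmorphB /=; field.
rewrite cabsM cabsV cabs_real ltr_pdivrMr ?cabs_gt0 // mul1r normrM.
case/andP: eps01 => e0 e1; rewrite gtr0_norm //.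
apply: (le_lt_trans (y := eps * cabs (z - w))).
  by rewrite ler_pM2l // tent_lipschitz.
by rewrite gtr_pMl // cabs_gt0.
Qed.

Lemma push_inj : injective push.
Proof.
move=> z w e; apply/eqP; apply: contrapT => /negP zw.
by have := push_slope zw; rewrite /= e subrr mul0r sub0r cabsN cabs1 ltxx.
Qed.

(** The push is horizontal, so surjectivity reduces to the intermediate value
    theorem on a horizontal line. *)
Lemma push_surj w : exists z, push z = w.
Proof.
pose g x : R := x + eps * tent (x +i* Im w).
case/andP: eps01 => e0 e1.
have cg : continuous g.
  apply/ctsT => x; apply: cts_add; first exact: cts_id.
  apply: cts_mull; apply: (cts_comp (g := tent)); first exact: cts_tent.
  by apply: cts_complex; [exact: cts_id | exact: cts_cst].
have [|||x _ gx] := @IVT R g (Re w - r) (Re w) (Re w).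
- by rewrite gerBl ltW.
- exact: continuous_subspaceT.
- rewrite ge_min le_max; apply/andP; split; apply/orP; [left|right].
    have h1 := tent_le ((Re w - r) +i* Im w); have h2 := tent_ge0 ((Re w - r) +i* Im w).
    rewrite /g; have : eps * tent ((Re w - r) +i* Im w) <= tent ((Re w - r) +i* Im w).
      by rewrite ler_piMl // ltW.
    lra.
  by rewrite /g lerDl mulr_ge0 ?tent_ge0 // ltW.
exists (x +i* Im w); apply: cplxP; rewrite /push ?ReD ?ImD /=; first exact: gx.
by rewrite addr0.
Qed.

Lemma push_homeo : exists T : homeo P P, oriented_homeo T /\
  forall p, T p = push_map p.
Proof.
have /choice[k kP] := push_surj.
have kK z : k (push z) = z by apply: push_inj; rewrite kP.
pose K (p : P) : P := match p with Some z => Some (k z) | None => None end.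
have cpush p : cts push_map p.
  case: p => [z|].
    by apply/cts_chart; apply: (cts_comp (g := Some : C -> P)) (cts_push z); exact: (cts_param (Some 0)).
  apply: cts_None_None => // M; exists (`|M| + cabs z0 + r) => z w zM [<-].
  have h1 := cabs_sub_ge z z0; have h2 := cabs_ge0 z0.
  have h3 := ler_norm M; have h4 := normr_ge0 M.
  have h5 : r <= cabs (z - z0) by lra.
  have h6 : M < cabs z by have := r0; lra.
  by rewrite push_out.
have [|p|h [hE hI]] := @bijective_homeo P P push_map (@P1_compact R) (@P1_hausdorff R) cpush K.
- by case=> [z|] //=; rewrite kK.
- by case: p => [z|] //=; rewrite kP.
exists h; split=> [p|p]; last by rewrite hE.
apply: (@turns_once_near _ push_map); first by rewrite hE; apply: filterS filterT.
case: p => [z|].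
  exists (fun w => logR ((push w - push z) / (w - z))).
  apply: filterS filterT => w _ wz.
  have Rq := near_one_Re (push_slope wz).
  have wz0 : w - z != 0 by rewrite subr_eq0.
  split; last by rewrite logRK // expr1 mulrC divfK.
  apply: (cts_comp (f := fun w => (push w - push z) / (w - z)) (cts_logR Rq)).
  apply: (cts_div (g := fun w => w - z) wz0); first by apply: cts_addr; exact: cts_push.
  exact/cts_addr/cts_id.
apply: winds_near (winds_id 0); apply/nbhsC.
have c1 : 0 < cabs z0 + r by rewrite ltr_wpDl ?cabs_ge0.
exists (cabs z0 + r)^-1 => [|w]; first by rewrite invr_gt0.
rewrite subr0 => h1; rewrite /P1_local /=; case: eqP => [->|/eqP w0] //=.
rewrite push_out ?invrK //.
have : cabs z0 + r < cabs w^-1.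
  rewrite cabsV -[cabs z0 + r]invrK ltf_pV2 // posrE ?cabs_gt0 // invr_gt0 //.
have := cabs_sub_ge w^-1 z0; lra.
Qed.

Lemma push_ratio z : r <= cabs z0 -> z != 0 -> 0 < Re (push z / z).
Proof.
move=> rz zn; apply: near_one_Re.
have -> : push z / z - 1 = (eps * tent z)%:C / z by rewrite /push; field.
case/andP: eps01 => e0 e1.
rewrite cabsM cabsV cabs_real ltr_pdivrMr ?cabs_gt0 // mul1r.
have tz : tent z <= cabs z.
  rewrite /tent ge_max cabs_ge0 /=.
  by have := cabs_sub_ge z0 (z0 - z); rewrite subKr (cabsB z0 z); lra.
rewrite ger0_norm ?mulr_ge0 ?tent_ge0 ?(ltW e0) //.
apply: (le_lt_trans (y := eps * cabs z)); first by rewrite ler_pM2l.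
by rewrite gtr_pMl // cabs_gt0.
Qed.

End Bump.

(** * Moebius transformations fixing few points *)

Lemma eq_from1 (K : comNzRingType) (l r k x y : K) :
  l = r -> x - y = k * (l - r) -> x = y.
Proof. by move=> ->; rewrite subrr mulr0 => /subr0_eq. Qed.

Lemma eq_from2 (K : comNzRingType) (l r k l' r' k' x y : K) :
  l = r -> l' = r' -> x - y = k * (l - r) + k' * (l' - r') -> x = y.
Proof. by move=> -> ->; rewrite !subrr !mulr0 addr0 => /subr0_eq. Qed.

Section Moebius.
Variable R : realType.
Notation C := (cplx R).
Notation P := (P1 R).
Variables (a b c d e : C).
Hypotheses (D0 : a * d - b * c != 0) (e2 : e ^+ 2 = 1).

Definition scale (p : P) : P :=
  match p with Some z => Some (e * z) | None => None end.

Lemma moebius_Some z w : moebius a b c d (Some z) = Some w -> a * z + b = w * (c * z + d).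
Proof. by rewrite /=; case: eqP => // /eqP n [<-]; rewrite divfK. Qed.

Lemma moebius_None : moebius a b c d None = None -> c = 0.
Proof. by rewrite /=; case: eqP. Qed.

Lemma scale_unit : e != 0.
Proof. by apply: contra_eq_neq e2 => ->; rewrite expr0n eq_sym oner_neq0. Qed.

(** The solutions of [M z = e * z] are the zeros of a quadratic polynomial, and
    infinity is one if the leading coefficient vanishes; three solutions make the
    polynomial vanish. *)
Lemma moebius_three p1 p2 p3 : p1 <> p2 -> p1 <> p3 -> p2 <> p3 ->
  moebius a b c d p1 = scale p1 -> moebius a b c d p2 = scale p2 ->
  moebius a b c d p3 = scale p3 ->
  forall s v, moebius a b c d (Some s) = Some v -> v = e * s.
Proof.
have quad z : moebius a b c d (Some z) = scale (Some z) ->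
    e * c * z ^+ 2 + (e * d - a) * z - b = 0.
  by move/moebius_Some => h; apply: (eq_from1 (k := -1) h); ring.
have lin z w : z != w -> c = 0 ->
    moebius a b c d (Some z) = scale (Some z) ->
    moebius a b c d (Some w) = scale (Some w) -> a = e * d /\ b = 0.
  move=> zw c0 /quad h1 /quad h2; rewrite c0 in h1 h2.
  have : (e * d - a) * (z - w) = 0 by apply: (eq_from2 (k := 1) (k' := -1) h1 h2); ring.
  move/eqP; rewrite mulf_eq0 !subr_eq0 (negPf zw) orbF => /eqP ad.
  split; first exact/esym.
  by apply: (eq_from2 (k := -1) (k' := z) h1 ad); ring.
suff H : p1 <> p2 -> p1 <> p3 -> p2 <> p3 ->
    moebius a b c d p1 = scale p1 -> moebius a b c d p2 = scale p2 ->
    moebius a b c d p3 = scale p3 -> [/\ a = e * d, b = 0 & c = 0].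
  move=> n12 n13 n23 h1 h2 h3 s v; have [ad b0 c0] := H n12 n13 n23 h1 h2 h3.
  move/moebius_Some; rewrite ad b0 c0 => h.
  have d0 : d != 0 by apply: contra D0 => /eqP d0; rewrite d0 b0 mulr0 mul0r subrr.
  by apply: (mulIf d0); apply: (eq_from1 (k := -1) h); ring.
case: p1 => [z1|]; case: p2 => [z2|]; case: p3 => [z3|] // n12 n13 n23 h1 h2 h3.
- have z12 : z1 - z2 != 0 by rewrite subr_eq0; apply/eqP => h; apply: n12; rewrite h.
  have z13 : z1 - z3 != 0 by rewrite subr_eq0; apply/eqP => h; apply: n13; rewrite h.
  have z23 : z2 - z3 != 0 by rewrite subr_eq0; apply/eqP => h; apply: n23; rewrite h.
  have [q1 q2 q3] := And3 (quad _ h1) (quad _ h2) (quad _ h3).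
  have k12 : e * c * (z1 + z2) + (e * d - a) = 0.
    by apply: (mulfI z12); rewrite mulr0; apply: (eq_from2 (k := 1) (k' := -1) q1 q2); ring.
  have k13 : e * c * (z1 + z3) + (e * d - a) = 0.
    by apply: (mulfI z13); rewrite mulr0; apply: (eq_from2 (k := 1) (k' := -1) q1 q3); ring.
  have c0 : c = 0.
    apply: (mulfI z23); apply: (mulfI scale_unit); rewrite !mulr0.
    by apply: (eq_from2 (k := 1) (k' := -1) k12 k13); ring.
  have [] := lin z1 z2 _ c0 h1 h2; first by rewrite -subr_eq0.
  by [].
- have c0 := moebius_None h3; have [] := lin z1 z2 _ c0 h1 h2; last by [].
  by apply/eqP => h; apply: n12; rewrite h.
- have c0 := moebius_None h2; have [] := lin z1 z3 _ c0 h1 h3; last by [].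
  by apply/eqP => h; apply: n13; rewrite h.
- have c0 := moebius_None h1; have [] := lin z2 z3 _ c0 h2 h3; last by [].
  by apply/eqP => h; apply: n23; rewrite h.
Qed.

(** The conditions at [s] and [- s] express [a] and [b] by [c] and [d]; each of the two
    others then fixes the ratio of [c] to [d], and comparing them determines
    [v ^+ 2]. *)
Lemma moebius_pair (s v alpha : C) (q : P) :
  s != 0 -> v != 0 -> v != e * s -> alpha != 0 -> q <> Some alpha ->
  moebius a b c d (Some s) = Some v -> moebius a b c d (Some (- s)) = Some (- v) ->
  moebius a b c d (Some alpha) = scale (Some alpha) ->
  moebius a b c d q = scale q ->
  exists2 beta, q = Some beta & v ^+ 2 * s ^+ 2 = (alpha * beta) ^+ 2.
Proof.
move=> s0 v0 ves al0 qal /moebius_Some h1 /moebius_Some h2 /moebius_Some h3 h4.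
have two0 : (2 : C) != 0 by rewrite pnatr_eq0.
have bE : b = v * c * s by apply: (mulfI two0); apply: (eq_from2 (k := 1) (k' := 1) h1 h2); ring.
have aE : a * s = v * d by apply: (mulfI two0); apply: (eq_from2 (k := 1) (k' := -1) h1 h2); ring.
have k z : a * z + b = e * z * (c * z + d) ->
    d * z * (v - e * s) = c * (e * s * z ^+ 2 - v * s ^+ 2).
  move=> h; have h' : z * (a * s) + s * b = s * (e * z * (c * z + d)) by rewrite -h; ring.
  by rewrite aE bE in h'; apply: (eq_from1 (k := 1) h'); ring.
have ka := k _ h3.
have ves0 : v - e * s != 0 by rewrite subr_eq0.
have c0 : c != 0.
  apply/eqP => c0; move/eqP: ka; rewrite c0 mul0r !mulf_eq0 (negPf al0) (negPf ves0) !orbF.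
  by move=> /eqP d0; move/eqP: D0; apply; rewrite d0 c0; ring.
case: q qal h4 => [beta|] qal h4; last by move/eqP: c0; rewrite (moebius_None h4).
exists beta => //; have kb := k _ (moebius_Some h4).
have ab0 : alpha - beta != 0.
  by rewrite subr_eq0; apply/eqP => h; apply: qal; rewrite h.
have b0 : beta != 0.
  apply/eqP => b0; move/eqP: kb; rewrite b0 mulr0 mul0r eq_sym mulf_eq0 (negPf c0) /=.
  by rewrite expr0n mulr0 sub0r oppr_eq0 mulf_eq0 (negPf v0) expf_eq0 (negPf s0).
have key : e * (alpha * beta) + v * s = 0.
  apply: (mulfI ab0); apply: (mulfI s0); apply: (mulfI c0); rewrite !mulr0.
  by apply: (eq_from2 (k := - beta) (k' := alpha) ka kb); ring.
have -> : v ^+ 2 * s ^+ 2 = (v * s) ^+ 2 by ring.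
have -> : v * s = - (e * (alpha * beta)) by apply: (eq_from1 (k := 1) key); ring.
by rewrite sqrrN exprMn e2 mul1r.
Qed.

End Moebius.

(** * The pullback map is not constant *)

Section Conclusion.
Variable R : realType.
Notation C := (cplx R).
Notation P := (P1 R).

Lemma avoid_three (T : choiceType) (A : set T) (x y z : T) : (`I_4 #<= A)%card ->
  exists p, [/\ A p, p <> x, p <> y & p <> z].
Proof.
move=> A4; apply: contrapT => H.
have AX : A `<=` [set x; y; z].
  move=> p Ap; apply: contrapT => np; apply: H; exists p; split=> //.
  - by move=> e; apply: np; left; left.
  - by move=> e; apply: np; left; right.
  - by move=> e; apply: np; right.
have := card_le_trans A4 (subset_card_le AX).
pose g (p : T) : nat := if p == x then 0%N else if p == y then 1%N else 2%N.
have : ([set x; y; z] #<= `I_3)%card.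
  have gI : {in [set x; y; z] &, injective g}.
    have zE t : [set x; y; z] t -> t != x -> t != y -> t = z.
      by case=> [[->|->]|->]; rewrite ?eqxx.
    move=> p q; rewrite !inE => pX qX; rewrite /g.
    case: (eqVneq p x) => [->|px]; case: (eqVneq q x) => [->|qx] //; try by case: ifP.
    case: (eqVneq p y) => [->|py]; case: (eqVneq q y) => [->|qy] // _.
    by rewrite (zE p) // (zE q).
  rewrite -(card_le_eql (inj_card_eq gI)); apply: subset_card_le.
  by move=> _ [p _ <-]; rewrite /g /=; case: ifP => // _; case: ifP.
by move=> h /card_le_trans/(_ h); rewrite card_le_II.
Qed.

Variables (S : oriented_sphere R) (f : S -> S).

Lemma teich_refl (phi : marking S) : teich_equiv f phi phi.
Proof.
exists (moebius 1 0 0 1); first by exists 1, 0, 0, 1; rewrite mulr1 mulr0 subr0 oner_neq0.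
have -> : moebius 1 0 0 1 \o phi = phi :> (S -> P).
  apply/funext => x /=; case: (phi x) => [z|] /=; last by rewrite eqxx.
  by rewrite !mul0r !add0r oner_eq0 mul1r addr0 divr1.
exists (fun _ => phi : S -> P); split=> //.
- apply/continuous_subspaceT/ctsT => p.
  apply: (cts_comp (g := phi) (f := snd)); first exact: cts_homeo.
  by split; exact: cvg_snd.
- by move=> t _; exists phi.
Qed.

Lemma teich_eq_moebius (phi psi : marking S) : teich f phi = teich f psi ->
  exists a b c d : C, a * d - b * c != 0 /\
    forall x, postcritical_set f x -> psi x = moebius a b c d (phi x).
Proof.
move=> /(congr1 (@sval _ _)) /= e.
have : teich_class f phi psi by rewrite e; exact: teich_refl.
case=> _ [a [b [c [d [D ->]]]]] [H [_ _ H1 _ Hx]].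
exists a, b, c, d; split=> // x px.
by have := Hx 1 x; rewrite ler01 lexx H1; apply.
Qed.

(** The two markings are square roots of functions whose quotient has positive real
    part.  On the complement of the two critical points, which is connected, their
    own quotient therefore has a real part of constant sign, namely that of [e]. *)
Lemma compare_roots (psi1 psi2 : marking S) (h : C -> C) :
  (forall z, cts h z) -> h 0 = 0 ->
  (forall z, z != 0 -> 0 < Re (h z / z)) ->
  (forall x w, psi1 x = Some w -> square_map (psi2 x) = Some (h (w ^+ 2))) ->
  exists2 e : C, e ^+ 2 = 1 & forall x w, psi1 x = Some w ->
    exists v, [/\ psi2 x = Some v, v ^+ 2 = h (w ^+ 2) &
      w != 0 -> 0 < Re (e * v / w)].
Proof.
move=> ch h0 hR hE.
pose F := psi2 \o homeo_inv psi1.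
have cF p : cts F p by apply: cts_comp; [exact: cts_homeo | exact: cts_homeo_inv].
have FE z : square_map (F (Some z)) = Some (h (z ^+ 2)).
  by apply: hE; rewrite homeo_invK.
have [z|Q [cQ QE]] := planar_map cF; first by have := FE z; case: (F (Some z)).
have Q2 z : Q z ^+ 2 = h (z ^+ 2) by have := FE z; rewrite QE => -[].
pose q w := Q (cexp w) / cexp w.
have cq w : cts q w.
  apply: cts_div; [exact: cexp_neq0 | | exact: cts_cexp_at].
  exact: cts_comp (cQ _) (cts_cexp_at w).
have qn w : Re (q w) != 0.
  have : 0 < Re (q w ^+ 2) by rewrite expr_div_n Q2; apply: hR; rewrite expf_neq0 // cexp_neq0.
  case: (q w) => x y; rewrite expr2 /= => H; apply/eqP => x0; move: H.
  by rewrite x0 mul0r sub0r oppr_gt0 ltNge -expr2 sqr_ge0.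
have [e e2 eq] : exists2 e : C, e ^+ 2 = 1 & forall w, 0 < Re (e * q w).
  have [p0|n0] := ltP 0 (Re (q 0)).
    exists 1; first by rewrite expr1n.
    by move=> w; rewrite mul1r; exact: Re_sign_const cq qn _ _ p0.
  exists (-1); first by rewrite sqrrN expr1n.
  move=> w; rewrite mulN1r.
  apply: (@Re_sign_const R (fun w => - q w) _ _ 0).
  - by move=> v; exact: cts_opp.
  - by move=> v; rewrite ReN oppr_eq0.
  - by rewrite ReN oppr_gt0 lt_neqAle qn.
exists e => // x w xw; exists (Q w).
have wx : homeo_inv psi1 (Some w) = x by rewrite -xw homeoK.
split; [by rewrite -QE /F /= wx | exact: Q2 | move=> w0].
by have [l lw] := cexp_surj w0; have := eq l; rewrite /q lw mulrA.
Qed.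

Lemma sqr_pos_eq (e v w : C) : e ^+ 2 = 1 -> w != 0 -> v ^+ 2 = w ^+ 2 ->
  0 < Re (e * v / w) -> v = e * w.
Proof.
move=> e2 w0 /eqP; rewrite eqf_sqr => /orP[]/eqP ->.
all: move/eqP: e2; rewrite sqrf_eq1 => /orP[]/eqP ->; rewrite ?mul1r ?mulN1r ?opprK //.
all: by rewrite ?mulNr divff //= ltr0N1.
Qed.

Hypotheses (fT : thurston_map f) (f2 : has_degree f 2).

(** The marking [phi] is pushed at the point [f p1] only, so by [compare_roots] its
    pullback changes only on the fibre of [f p1], up to the sign [e]. *)
Lemma moved_pullback (c1 c2 p1 : S) (phi psi : marking S) :
  c1 <> c2 -> critical_points f c1 -> critical_points f c2 ->
  phi (f c1) = Some 0 -> phi (f c2) = None ->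
  (forall x, phi (f x) = square_map (psi x)) ->
  p1 <> c1 -> p1 <> c2 -> postcritical_set f p1 ->
  exists (r : R) (s : C), [/\ 0 < r, s != 0, psi p1 = Some s &
    forall eps : R, 0 < eps < 1 -> exists (phi' psi' : marking S) (e v : C),
      [/\ forall x, phi' (f x) = square_map (psi' x), e ^+ 2 = 1,
          v ^+ 2 = s ^+ 2 + (eps * r)%:C &
          [/\ psi' p1 = Some v,
          forall x, psi x = Some (- s) -> psi' x = Some (- v) &
          forall x, postcritical_set f x -> f x <> f p1 ->
            psi' x = scale e (psi x)]]].
Proof.
move=> c12 cc1 cc2 phi1 phi2 phipsi p1c1 p1c2 Pp1.
have [s ps] : exists s, psi p1 = Some s.
  case e: (psi p1) => [s|]; first by exists s.
  have := phipsi p1; rewrite e /= -phi2 => /(can_inj (homeoK phi)) h.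
  by case: p1c2; exact: (critical_fibre1 fT f2 cc2).
have s0 : s != 0.
  apply/eqP => s0; have := phipsi p1; rewrite ps s0 /= expr0n -phi1.
  by move/(can_inj (homeoK phi)) => h; case: p1c1; exact: (critical_fibre1 fT f2 cc1).
have phip : phi (f p1) = Some (s ^+ 2) by rewrite phipsi ps.
have Pf x : postcritical_set f x -> postcritical_set f (f x).
  by move=> [m m0 [c cc <-]]; exists m.+1 => //; exists c; rewrite // -iterS.
have [r r0 hr] : exists2 r : R, 0 < r & forall y w, postcritical_set f y ->
    y <> f p1 -> phi y = Some w -> r <= cabs (w - s ^+ 2).
  have cF : closed (postcritical_set f `\` [set f p1]).
    apply: accessible_finite_set_closed.1.
      exact: hausdorff_accessible (@sphere_hausdorff _ S).
    exact: finite_setD fT.2.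
  have nF : nbhs (f p1) (~` (postcritical_set f `\` [set f p1])).
    by apply: open_nbhs_nbhs; split; [exact: closed_openC | move=> [_ []]].
  have := near_homeo_inv phi nF; rewrite phip => /nbhs_Some/nbhsC[r r0 H].
  exists r => // y w Py yp yw; rewrite leNgt; apply/negP => /H; apply.
  by rewrite -yw homeoK.
have r_s : r <= cabs (s ^+ 2).
  have := hr (f c1) 0 (critical_value_post cc1) _ phi1; rewrite sub0r cabsN.
  by apply=> e; apply: p1c1; apply: (critical_fibre1 fT f2 cc1); rewrite e.
exists r, s; split=> // eps eps01.
have [T [oT TE]] := push_homeo (s ^+ 2) eps01 r0.
have [phi' phi'E] := marking_post phi oT.
have push0 : push eps r (s ^+ 2) 0 = 0 by rewrite push_out // sub0r cabsN.
have [d dP] := deck_exists fT f2.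
have [||psi' psi'E] := @root_marking _ _ f fT f2 d dP c1 c2 c12 cc1 cc2 phi'.
- by rewrite phi'E phi1 TE /= push0.
- by rewrite phi'E phi2 TE.
have sqE x : square_map (psi' x) = push_map eps r (s ^+ 2) (square_map (psi x)).
  by rewrite -psi'E phi'E TE phipsi.
have [||||e e2 He] := @compare_roots psi psi' (push eps r (s ^+ 2)).
- exact: cts_push.
- exact: push0.
- by move=> z z0; exact: push_ratio.
- by move=> x w xw; rewrite sqE xw.
have [v [pv v2 vR]] := He p1 s ps.
exists phi', psi', e, v; split=> //; first by rewrite v2 push_center.
split=> // [x xs|x Px fx].
  have [v' [pv' v'2 v'R]] := He x (- s) xs; rewrite pv'; congr Some.
  have : v' ^+ 2 = v ^+ 2 by rewrite v'2 v2 sqrrN.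
  move/eqP; rewrite eqf_sqr => /orP[]/eqP // v'v; rewrite v'v.
  have := v'R ltac:(by rewrite oppr_eq0); have := vR s0.
  by rewrite v'v invrN mulrN ReN oppr_gt0 => h1 /(lt_trans h1); rewrite ltxx.
case xw: (psi x) => [w|] /=; last first.
  by have := sqE x; rewrite xw /=; case: (psi' x).
have [v' [-> v'2 v'R]] := He x w xw; congr Some.
rewrite push_out in v'2; last first.
  by apply: (hr (f x)) => //; [exact: Pf | rewrite phipsi xw].
have [w0|w0] := eqVneq w 0; last by apply: sqr_pos_eq => //; exact: v'R.
by move/eqP: v'2; rewrite w0 expr0n mulr0 sqrf_eq0 => /eqP.
Qed.

End Conclusion.

Theorem theorem5p2 (R : realType) (S : oriented_sphere R) (f : S -> S)
    (Sigma : teich_space f -> teich_space f) :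
  thurston_map f ->
  has_degree f 2 ->
  (`I_4 #<= postcritical_set f)%card ->
  is_pullback_map Sigma ->
  ~ (exists c : teich_space f, forall t : teich_space f, Sigma t = c).
Proof.
move=> fT f2 P4 pull [k kP].
have [d dP] := deck_exists fT f2.
have Pne : postcritical_set f !=set0.
  pose x := homeo_inv (sphere_ref S) None.
  by have [p [Pp _ _ _]] := avoid_three x x x P4; exists p.
have [c1 [c2 [c12 cc1 cc2]]] := two_critical_points fT dP Pne.
have fc12 : f c1 <> f c2.
  by move=> e; apply: c12; exact: (critical_fibre1 fT f2 cc2).
have [phi [phi1 phi2]] := marking_0oo fc12.
have [psi phipsi] := root_marking fT f2 dP c12 cc1 cc2 phi1 phi2.
have [p1 [Pp1 p1c1 p1c2 _]] := avoid_three c1 c2 c2 P4.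
have [r [s [r0 s0 ps moved]]] := moved_pullback fT f2 c12 cc1 cc2 phi1 phi2 phipsi p1c1 p1c2 Pp1.
have same (psi' phi' : marking S) : (forall x, phi' (f x) = square_map (psi' x)) ->
    teich f psi = teich f psi'.
  move=> h; rewrite -(pull _ _ (holomorphic_pullback phipsi)).
  by rewrite -(pull _ _ (holomorphic_pullback h)) !kP.
have psiI : injective psi := can_inj (homeoK psi).
pose q := homeo_inv psi (Some (- s)).
have psq : psi q = Some (- s) by rewrite homeo_invK.
have fibre x : f x = f p1 -> x = p1 \/ x = q.
  move/(congr1 phi); rewrite !phipsi ps; case xw: (psi x) => [w|] //= [].
  move/eqP; rewrite eqf_sqr => /orP[]/eqP ws; [left|right]; apply: psiI.
    by rewrite xw ws ps.
  by rewrite xw ws psq.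
have psi_c1 : psi c1 = Some 0.
  have := phipsi c1; rewrite phi1; case: (psi c1) => [w|] //= [].
  by move/esym/eqP; rewrite sqrf_eq0 => /eqP ->.
have psi_c2 : psi c2 = None by have := phipsi c2; rewrite phi2; case: (psi c2).
have move_by (eps : R) : 0 < eps < 1 -> exists a b c d0 e v : cplx R,
    [/\ a * d0 - b * c != 0, e ^+ 2 = 1, v ^+ 2 = s ^+ 2 + (eps * r)%:C,
      v != 0 /\ v != e * s &
      [/\ moebius a b c d0 (Some s) = Some v,
        postcritical_set f q -> moebius a b c d0 (Some (- s)) = Some (- v) &
        forall x, postcritical_set f x -> x <> p1 -> x <> q ->
          moebius a b c d0 (psi x) = scale e (psi x)]].
  move=> eps01; have [phi' [psi' [e [v [h e2 v2 [pv qv Hx]]]]]] := moved eps eps01.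
  have [a [b [c [d0 [D HM]]]]] := teich_eq_moebius (same _ _ h).
  have v0 : v != 0.
    apply/eqP => v0; have : p1 = q.
      by apply: (can_inj (homeoK psi')); rewrite pv qv // v0 oppr0.
    move/(congr1 psi); rewrite ps psq => -[/eqP].
    by rewrite -addr_eq0 -mulr2n -mulr_natl mulf_eq0 pnatr_eq0 /= (negPf s0).
  exists a, b, c, d0, e, v; split=> //; [split=> // | split].
  - apply/eqP => ve; move: v2; rewrite ve exprMn e2 mul1r => /eqP.
    rewrite addrC -subr_eq subrr eq_sym => /eqP /(congr1 (@complex.Re R)) /= /eqP.
    by rewrite mulf_eq0 (gt_eqF r0) orbF; case/andP: eps01 => e0 _; rewrite (gt_eqF e0).
  - by rewrite -ps -HM.
  - by move=> Pq; rewrite -psq -HM // qv.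
  - by move=> x Px xp xq; rewrite -HM //; apply: Hx => // /fibre[].
have half : 0 < (2^-1 : R) < 1 by rewrite invr_gt0 ltr0n invf_lt1 ?ltr1n ?ltr0n.
have third : 0 < (3^-1 : R) < 1 by rewrite invr_gt0 ltr0n invf_lt1 ?ltr1n ?ltr0n.
have psi_neq x y : x <> y -> psi x <> psi y by move=> xy /psiI.
case: (pselect (postcritical_set f q)) => [Pq|nPq]; last first.
  (* M acts on three points of P_f besides p1 as multiplication by e *)
  have nq x : postcritical_set f x -> x <> q by move=> Px xq; rewrite -xq in nPq.
  have [p2 [Pp2 p21 _ _]] := avoid_three p1 p1 p1 P4.
  have [p3 [Pp3 p31 p32 _]] := avoid_three p1 p2 p2 P4.
  have [p4 [Pp4 p41 p42 p43]] := avoid_three p1 p2 p3 P4.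
  have [a [b [c [d0 [e [v [D e2 _ [_ ve] [M1 _ MP]]]]]]]] := move_by _ half.
  move/eqP: ve; apply; apply: (moebius_three D e2 _ _ _ _ _ _ M1).
  - exact: psi_neq (nesym p32).
  - exact: psi_neq (nesym p42).
  - exact: psi_neq (nesym p43).
  - by apply: MP => //; exact: nq.
  - by apply: MP => //; exact: nq.
  - by apply: MP => //; exact: nq.
have crit x : critical_points f x -> x = c1 \/ x = c2.
  move=> cx; case xw: (psi x) => [w|]; last by right; apply: psiI; rewrite xw.
  left; apply: psiI; rewrite xw psi_c1; congr Some.
  have : homeo_inv psi (Some (- w)) = x.
    apply: (critical_fibre1 fT f2 cx); apply: (can_inj (homeoK phi)).
    by rewrite !phipsi homeo_invK xw /= sqrrN.
  move/(congr1 psi); rewrite homeo_invK xw => -[/eqP].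
  by rewrite eq_sym -addr_eq0 -mulr2n -mulr_natl mulf_eq0 pnatr_eq0 /= => /eqP.
(* P_f is the union of the critical values and of its own image, so it would
   otherwise consist of f p1, f c1 and f c2 *)
have [p3 [Pp3 p31 p3q [p3c1 p3c2]]] : exists x, [/\ postcritical_set f x, x <> p1,
    x <> q & x <> c1 /\ x <> c2].
  apply: contrapT => H.
  have Pcover x : postcritical_set f x -> [\/ f x = f p1, f x = f c1 | f x = f c2].
    move=> Px; apply: contrapT => nx; apply: H; exists x; split=> //.
    - by move=> e; apply: nx; rewrite e; apply: Or31.
    - by move=> e; apply: nx; apply: Or31; apply/(can_inj (homeoK phi)); rewrite !phipsi e psq ps /= sqrrN.
    - by split=> e; apply: nx; rewrite e; [apply: Or32 | apply: Or33].
  have [y [[m m0 [c cc <-]] y1 y2 y3]] := avoid_three (f p1) (f c1) (f c2) P4.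
  case: m m0 y1 y2 y3 => [|[|m]] // _ y1 y2 y3.
    by case: (crit c cc) => e; [apply: y2 | apply: y3]; rewrite e.
  have : postcritical_set f (iter m.+1 f c) by exists m.+1 => //; exists c.
  by case/Pcover => e; [apply: y1 | apply: y2 | apply: y3].
have [p4 [Pp4 p41 p4q p43]] := avoid_three p1 q p3 P4.
have [al al0 p3al] : exists2 al, al != 0 & psi p3 = Some al.
  case e: (psi p3) => [al|]; last by case: p3c2; apply: psiI; rewrite e.
  by exists al => //; apply/eqP => al0; apply: p3c1; apply: psiI; rewrite e al0.
have pinned (eps : R) : 0 < eps < 1 ->
    exists2 be, psi p4 = Some be & (s ^+ 2 + (eps * r)%:C) * s ^+ 2 = (al * be) ^+ 2.
  move=> /move_by[a [b [c [d0 [e [v [D e2 v2 [v0 ve] [M1 M2 MP]]]]]]]].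
  rewrite -v2; apply: (moebius_pair D e2 s0 v0 ve al0 _ M1 (M2 Pq)).
  - by rewrite -p3al; exact: psi_neq.
  - by rewrite -p3al; exact: MP.
  - exact: MP.
(* [al] and [be] do not depend on eps, so two values of eps cannot both occur *)
have [be e1 h1] := pinned _ half; have [be' e3 h3] := pinned _ third.
move: e3; rewrite e1 => -[be_eq]; rewrite -be_eq -h1 in h3.
have s20 : s ^+ 2 != 0 by rewrite expf_neq0.
move/(mulIf s20)/addrI/(congr1 (@complex.Re R)) : h3 => /= /(mulIf (lt0r_neq0 r0)).
by move/invr_inj/eqP; rewrite eqr_nat.
Qed.
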